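(* Let $G_{k,m}(t,\mathbb{L};\lambda_2,\lambda_3,\dots)$, $k,m\ge 1$, be the rational functions defined in the context, let $$H_{k,m}(\mathbb{L};\lambda_2,\lambda_3,\ldots)=\frac{G_{k,m}(1,\mathbb{L};\lambda_2,\lambda_3,\ldots)}{G_{k,m}(1,\mathbb{L};\mathbb{L},\mathbb{L},\ldots)},$$ and define the generating function $$H(a,b,\mathbb{L};\lambda_2,\lambda_3,\ldots)=\sum_{k,m=1}^{\infty}a^kb^mH_{k,m}(\mathbb{L};\lambda_2,\lambda_3,\ldots).$$ (i) For every integer $\alpha\ge2$, $$\frac{\partial}{\partial\lambda_\alpha}H(a,b,\mathbb{L};\lambda_2,\lambda_3,\ldots)=\frac{1-\mathbb{L}^{-\alpha}}{(\lambda_\alpha-1)(1-\lambda_\alpha\mathbb{L}^{-\alpha})}\cdot H_{\alpha,\alpha}(\mathbb{L};\lambda_2,\lambda_3,\ldots,\lambda_\alpha)\cdot H(a^\alpha,b^\alpha,\mathbb{L}^\alpha;\lambda_{2\alpha},\lambda_{3\alpha},\ldots).$$ (ii) More generally, let $2\le\alpha_1<\alpha_2<\dots<\alpha_n$ be integers and let $k_1,\dots,k_n$ be positive integers. If $\alpha_j\mid\alpha_{j+1}$ for all $j=1,\dots,n-1$, then $$\frac{\partial^{k_1+\cdots+k_n}}{\partial\lambda_{\alpha_1}^{k_1}\cdots\partial\lambda_{\alpha_n}^{k_n}}H(a,b,\mathbb{L};\lambda_2,\lambda_3,\ldots)=\prod_{j=1}^{n}\left[\frac{(1-\mathbb{L}^{-\alpha_j})\,\mathbb{L}^{\alpha_j(k_j-1)}}{(\lambda_{\alpha_j}-1)(1-\lambda_{\alpha_j}\mathbb{L}^{-\alpha_j})^{k_j}}\right]\cdot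 H_{\alpha_1,\alpha_1}(\mathbb{L};\lambda_2,\lambda_3,\ldots)$$ $$\times\prod_{j=2}^{n}H_{\frac{\alpha_j}{\alpha_{j-1}},\frac{\alpha_j}{\alpha_{j-1}}}(\mathbb{L}^{\alpha_{j-1}};\lambda_{2\alpha_{j-1}},\lambda_{3\alpha_{j-1}},\ldots)\cdot H(a^{\alpha_n},b^{\alpha_n},\mathbb{L}^{\alpha_n};\lambda_{2\alpha_n},\lambda_{3\alpha_n},\ldots),$$ and otherwise (if $\alpha_j\nmid\alpha_{j+1}$ for some $j$) the derivative vanishes.
   Context: Let $\mathbb{L},t,\lambda_2,\lambda_3,\dots$ be independent variables and put $\lambda_1=\mathbb{L}$. $(G_{k,m})_{k,m\ge1}$ is the family in $\mathbb{Z}[\lambda_2,\lambda_3,\dots]((\mathbb{L}^{-1}))[[t]]$ determined by $G_{1,1}=(\mathbb{L}-1)^2\mathbb{L}^{-2}$ and, for all $k,m\ge1$, $$G_{k,m}=G_{m,k};\qquad G_{k,m}=t^{k(k-1)}\mathbb{L}^{-k}\,G_{k,m-k}\ \text{ for } m>k;\qquad G_{k,k}=(\lambda_k-1)\sum_{m>k}G_{k,m}$$ (infinite sums converging coefficientwise in $t$ in the $\mathbb{L}^{-1}$-adic topology). Each $G_{k,m}=G_{k,m}(t,\mathbb{L};\lambda_2,\lambda_3,\dots)$ is the expansion of a unique rational function in $t,\mathbb{L}$ and finitely many $\lambda_i$, with which it is identified; $G_{k,m}(1,\mathbb{L};\dots)$ is its value at $t=1$, and $G_{k,m}(1,\mathbb{L};\mathbb{L},\mathbb{L},\dots)$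 is obtained by further setting all $\lambda_i=\mathbb{L}$. $H$ is a formal power series in $a,b$ with coefficients in the field of rational functions in $\mathbb{L},\lambda_2,\lambda_3,\dots$. $H_{\alpha,\alpha}$ depends only on $\mathbb{L}$ and those $\lambda_i$ with $i\le\alpha$. $H_{k,m}(\mathbb{L}^\alpha;\lambda_{2\alpha},\lambda_{3\alpha},\dots)$ denotes the result of substituting $\mathbb{L}\mapsto\mathbb{L}^\alpha$ and $\lambda_i\mapsto\lambda_{i\alpha}$ ($i\ge2$) in $H_{k,m}$, and similarly $H(a^\alpha,b^\alpha,\mathbb{L}^\alpha;\lambda_{2\alpha},\lambda_{3\alpha},\dots)=\sum_{k,m\ge1}a^{\alpha k}b^{\alpha m}H_{k,m}(\mathbb{L}^\alpha;\lambda_{2\alpha},\lambda_{3\alpha},\dots)$.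
   Formalization: In (ii) the factor L^{α_j(k_j−1)} is corrected to k_j!·L^{−α_j(k_j−1)}; the printed formula fails for n=1, α_1=2, k_1=2 at a²b², where the true second derivative is 2L^{−3}(1−L^{−2})/(1−λ_2L^{−2})³. Both agree when all k_j=1. *)

(* Defs.v *)
From HB Require Import structures.
From Stdlib Require Import ClassicalEpsilon.
From mathcomp Require Import all_boot all_order all_algebra.
From mathcomp Require Import finmap.
From mathcomp.multinomials Require Import monalg.

Set Implicit Arguments.
Unset Strict Implicit.
Unset Printing Implicit Defensive.

Import GRing.Theory.
Local Open Scope ring_scope.

Local Notation "1" := (@mone _) : monom_scope.
Local Notation "x * y" := (mmul x y) : monom_scope.

(* Z[x_0, x_1, x_2, ...]. The variables are t = x_0, L = x_1 and
   lambda_i = x_i for i >= 2, so that lambda_1 = L holds on the nose.          *)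
Definition lpoly : Type := {malg int[{cmonom nat}]}.

HB.instance Definition _ := GRing.ComNzRing.on lpoly.

(* lpoly is an integral domain: Kronecker's substitution x_i := X^(B^i) is a
   ring morphism to Z[X] which is injective on polynomials whose exponents
   are smaller than B.                                                        *)
Section Kronecker.

Local Open Scope fset_scope.

Definition kwgt (B : nat) (m : {cmonom nat}) : nat :=
  (\sum_(i <- finsupp m) m i * B ^ i)%N.

Lemma kwgtEw B (m : {cmonom nat}) (d : {fset nat}) : finsupp m `<=` d ->
  kwgt B m = (\sum_(i <- d) m i * B ^ i)%N.
Proof.
move=> le; rewrite /kwgt (big_fset_incl _ le) //.
by move=> i i_in_d; rewrite -cmE_neq0 negbK => /eqP->.
Qed.

Lemma kwgt1 B : kwgt B 1%M = 0%N.
Proof. by rewrite /kwgt mdom1 big_seq_fset0. Qed.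

Lemma kwgtM B m1 m2 : kwgt B (m1 * m2)%M = (kwgt B m1 + kwgt B m2)%N.
Proof.
rewrite [LHS]/kwgt mdomD (kwgtEw B (fsubsetUl _ (finsupp m2))).
rewrite [X in (_ + X)%N](kwgtEw B (fsubsetUr (finsupp m1) _)).
by rewrite -big_split /=; apply/eq_bigr=> /= i _; rewrite cmM mulnDl.
Qed.

Lemma digits_inj B N (f g : nat -> nat) :
  (forall i, (f i < B)%N) -> (forall i, (g i < B)%N) ->
  (\sum_(i < N) f i * B ^ i = \sum_(i < N) g i * B ^ i)%N ->
  forall i, (i < N)%N -> f i = g i.
Proof.
elim: N f g => [|N IH] f g hf hg //.
rewrite !big_ord_recl /= expn0 !muln1.
have rw h : (\sum_(i < N) h (bump 0 i) * B ^ bump 0 i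
             = (\sum_(i < N) h i.+1 * B ^ i) * B)%N.
  rewrite big_distrl /=; apply: eq_bigr => i _.
  by rewrite /bump leq0n add1n expnSr mulnA.
rewrite !rw => E.
have E0 : f 0%N = g 0%N.
  move/(congr1 (modn^~ B)): E.
  by rewrite ![(_ + _ * B)%N]addnC !modnMDl !modn_small.
have B_gt0 : (0 < B)%N by apply: leq_ltn_trans (hf 0%N).
have E1 : (\sum_(i < N) f i.+1 * B ^ i = \sum_(i < N) g i.+1 * B ^ i)%N.
  by move: E; rewrite E0 => /addnI /eqP; rewrite eqn_pmul2r // => /eqP.
by case=> [|i] //=; apply: (IH (f \o succn) (g \o succn)) E1 i => j /=.
Qed.

Lemma kwgt_ord B (m : {cmonom nat}) N :
  (forall i, i \in finsupp m -> (i < N)%N) ->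
  kwgt B m = (\sum_(i < N) m i * B ^ i)%N.
Proof.
move=> le; rewrite (kwgtEw B (d := seq_fset tt (iota 0 N))); last first.
  by apply/fsubsetP=> i /le lt; rewrite seq_fsetE mem_iota.
rewrite -(big_mkord xpredT (fun i => m i * B ^ i)%N) /index_iota subn0.
apply: perm_big; apply: uniq_perm; rewrite ?fset_uniq ?iota_uniq //.
by move=> i; rewrite seq_fsetE.
Qed.

Lemma kwgt_inj B (m1 m2 : {cmonom nat}) :
  (forall i, (m1 i < B)%N) -> (forall i, (m2 i < B)%N) ->
  kwgt B m1 = kwgt B m2 -> m1 = m2.
Proof.
move=> h1 h2; pose N := (\sum_(i <- finsupp (m1 * m2)%M) i).+1.
have hN i : i \in finsupp (m1 * m2)%M -> (i < N)%N.
  by move=> hi; rewrite ltnS (big_fsetD1 i) //= leq_addr.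
have hN1 i : i \in finsupp m1 -> (i < N)%N.
  by move=> hi; apply: hN; rewrite mdomD in_fsetU hi.
have hN2 i : i \in finsupp m2 -> (i < N)%N.
  by move=> hi; apply: hN; rewrite mdomD in_fsetU hi orbT.
rewrite (kwgt_ord B hN1) (kwgt_ord B hN2) => /(digits_inj h1 h2) E.
apply/eqP/cmP => i; case: (ltnP i N) => [|le]; first exact: E.
have E1 : m1 i == 0%N by rewrite cmE_eq0; apply/negP => /hN1; rewrite ltnNge le.
have E2 : m2 i == 0%N by rewrite cmE_eq0; apply/negP => /hN2; rewrite ltnNge le.
by rewrite (eqP E1) (eqP E2).
Qed.

Definition kmon (B : nat) (m : {cmonom nat}) : {poly int} := 'X^(kwgt B m).

Lemma kmon_morph B : mmorphism (kmon B).
Proof.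
by split=> [m1 m2|]; rewrite /kmon ?kwgtM ?exprD // kwgt1 expr0.
Qed.

HB.instance Definition _ B :=
  isMultiplicative.Build {cmonom nat} {poly int} (kmon B) (kmon_morph B).

Definition kron (B : nat) : lpoly -> {poly int} := mmap polyC (kmon B).

Lemma kronM B : {morph kron B : p q / p * q}.
Proof. by move=> p q; rewrite /kron rmorphM. Qed.

Lemma kron1 B : kron B 1 = 1.
Proof. by rewrite /kron rmorph1. Qed.

Definition kbound (p : lpoly) : nat := (\sum_(m <- msupp p) mdeg m).+1.

Lemma kboundP (p : lpoly) m i : m \in msupp p -> (m i < kbound p)%N.
Proof.
move=> hm; rewrite ltnS (big_fsetD1 m) //=.
apply: leq_trans (leq_addr _ _); rewrite mdegE.
case: mdomP => // hi; by rewrite (big_fsetD1 i) //= leq_addr.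
Qed.

Lemma coef_kron B (p : lpoly) m : (kbound p <= B)%N -> m \in msupp p ->
  (kron B p)`_(kwgt B m) = p@_m.
Proof.
move=> hB hm; rewrite /kron mmapE coef_sum (big_fsetD1 m) //= big_seq big1.
  by rewrite addr0 /kmon coefCM coefXn eqxx mulr1.
move=> m'; rewrite in_fsetD1 => /andP[ne hm'].
rewrite /kmon coefCM coefXn; case: eqP => [E|]; last by rewrite mulr0.
have lt m0 (h : m0 \in msupp p) i : (m0 i < B)%N.
  exact: leq_trans (kboundP i h) hB.
by move: ne; rewrite (kwgt_inj (lt _ hm) (lt _ hm') E) eqxx.
Qed.

Lemma lpoly_supp (p : lpoly) : p != 0 -> exists m, m \in msupp p.
Proof. by rewrite -msupp_eq0 => /fset0Pn. Qed.

Lemma kron_eq0 B (p : lpoly) : (kbound p <= B)%N -> kron B p = 0 -> p = 0.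
Proof.
move=> hB E; case: (eqVneq p 0) => // /lpoly_supp[m hm].
by move: (coef_kron hB hm); rewrite E coef0 => /esym/eqP; rewrite mcoeff_eq0 hm.
Qed.

Lemma lpoly_mulf_eq0 (p q : lpoly) : p * q = 0 -> (p == 0) || (q == 0).
Proof.
move=> E; pose B := maxn (kbound p) (kbound q).
have : kron B p * kron B q == 0 by rewrite -kronM E /kron raddf0.
rewrite mulf_eq0 => /orP[] /eqP /kron_eq0 ->; rewrite ?eqxx ?orbT //.
  exact: leq_maxl.
exact: leq_maxr.
Qed.

Lemma lpoly_unit_const (p q : lpoly) : p * q = 1 -> p = (p@_1%M)%:MP.
Proof.
move=> E; pose B := kbound p.
have [sz _] : size (kron B p) = 1 /\ size (kron B q) = 1.
  have : size (kron B p * kron B q) = 1 by rewrite -kronM E kron1 size_poly1.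
  by move/eqP; rewrite size_mul_eq1 => /andP[/eqP-> /eqP->].
apply/malgP => m; rewrite mcoeffC.
case: (eqVneq m 1%M) => [->|ne]; first by rewrite mulr1n.
rewrite mulr0n; apply/eqP; rewrite mcoeff_eq0; apply/negP => hm.
have := coef_kron (leqnn _) hm.
rewrite nth_default => [/esym/eqP|]; first by rewrite mcoeff_eq0 hm.
rewrite sz lt0n; apply/eqP => w0; case/eqP: ne; apply: (@kwgt_inj B).
- by move=> i; apply: kboundP.
- by move=> i; rewrite cm1.
- by rewrite -/B w0 kwgt1.
Qed.

End Kronecker.

Definition lpoly_unit : pred lpoly :=
  [pred p | (p == (p@_1%M)%:MP) && (p@_1%M \is a GRing.unit)].

Definition lpoly_inv (p : lpoly) : lpoly :=
  if lpoly_unit p then ((p@_1%M)^-1)%:MP else p.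

Lemma malgC_mul (c d : int) :
  c * d = 1 -> c%:MP * d%:MP = 1 :> {malg int[{cmonom nat}]}.
Proof. by move=> cd; have := @mpolyCM (cmonom nat) int c d; rewrite cd => <-. Qed.

Lemma malgC_mul1 (c d : int) :
  c%:MP * d%:MP = 1 :> {malg int[{cmonom nat}]} -> c * d = 1.
Proof.
have := @mpolyCM (cmonom nat) int c d => <- E.
have /eqP := etrans E (esym (@mpolyC1E (cmonom nat) int)).
by have := @malgC_eq (cmonom nat) int (c * d) 1 => -> /eqP.
Qed.

Lemma lpoly_mulVr : {in lpoly_unit, left_inverse 1 lpoly_inv *%R}.
Proof.
move=> p hp; have {}hp : lpoly_unit p := hp; rewrite /lpoly_inv hp.
case/andP: hp => /eqP E u; have := malgC_mul (mulVr u).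
by move: (p@_1%M) E => c ->.
Qed.

Lemma lpoly_unitPl (p q : lpoly) : q * p = 1 -> lpoly_unit p.
Proof.
move=> E; have E' : p * q = 1 by rewrite mulrC.
have Ep := lpoly_unit_const E'; have Eq := lpoly_unit_const E.
rewrite /lpoly_unit inE -Ep eqxx andTb.
apply/unitrPr; exists (q@_1%M).
move: (p@_1%M) (q@_1%M) Ep Eq => c d Ep Eq; subst p q.
exact: (malgC_mul1 E').
Qed.

Lemma lpoly_inv_out : {in [predC lpoly_unit], lpoly_inv =1 id}.
Proof.
by move=> p hp; have {}hp : ~~ lpoly_unit p := hp; rewrite /lpoly_inv ifN.
Qed.

HB.instance Definition _ := GRing.ComNzRing_hasMulInverse.Build lpoly
  lpoly_mulVr lpoly_unitPl lpoly_inv_out.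
HB.instance Definition _ :=
  GRing.ComUnitRing_isIntegral.Build lpoly lpoly_mulf_eq0.

Definition ratfun : Type := {fraction lpoly}.

HB.instance Definition _ := GRing.Field.on ratfun.

Definition frac_of (p : lpoly) : ratfun := @FracField.tofrac lpoly p.

Definition pvar (i : nat) : lpoly := << ucm i >>.

(* lam 1 is L; lam 0 would be t and is not used. *)
Definition lam (i : nat) : ratfun := frac_of (pvar i).
Definition Lvar : ratfun := lam 1.

(* Substitution x_i := s i. *)
Definition psubst (s : nat -> lpoly) : lpoly -> lpoly :=
  mmap (intmul 1) (fun m : {cmonom nat} => \prod_(i <- finsupp m) s i ^+ m i).

(* The value of x under x_i := s i is P(s) / Q(s) for any way of writing
   x = P / Q with Q(s) <> 0; it does not depend on the choice of P and Q. It
   is unspecified when there is no such P and Q, i.e. when x is not regular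
   at s.                                                                      *)
Definition fsubst (s : nat -> lpoly) (x : ratfun) : ratfun :=
  epsilon (inhabits 0) (fun y => exists p q : lpoly,
    [/\ psubst s q != 0,
        x = frac_of p / frac_of q
      & y = frac_of (psubst s p) / frac_of (psubst s q)]).

Definition at_t1 : ratfun -> ratfun :=
  fsubst (fun i => if i == 0%N then 1 else pvar i).

Definition all_lam_to_L : ratfun -> ratfun :=
  fsubst (fun i => if i == 0%N then pvar 0 else pvar 1).

(* L := L^al and lambda_i := lambda_(i al) for i >= 2. *)
Definition adams (al : nat) : ratfun -> ratfun :=
  fsubst (fun i => if i == 0%N then pvar 0
                   else if i == 1%N then pvar 1 ^+ al
                   else pvar (i * al)).

Definition pderiv (i : nat) (p : lpoly) : lpoly :=
  \sum_(m <- msupp p) << p@_m *+ m i *g divcm m (ucm i) >>.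

(* The partial derivative in lambda_i, by the quotient rule. *)
Definition dlam (i : nat) (x : ratfun) : ratfun :=
  let p := \n_(repr x) in let q := \d_(repr x) in
  frac_of (pderiv i p * q - p * pderiv i q) / frac_of q ^+ 2.

(* S i j is the coefficient of t^i L^j. The elements of
   Z[lambda_2, lambda_3, ...]((L^-1))[[t]] are the S with is_lseries S.       *)
Definition lseries : Type := nat -> int -> lpoly.

Definition lam_only (p : lpoly) : Prop :=
  forall m : {cmonom nat}, m \in msupp p -> m 0%N = 0%N /\ m 1%N = 0%N.

Definition is_lseries (S : lseries) : Prop :=
  (forall i j, lam_only (S i j)) /\
  (forall i, exists N : int, forall j : int, (N < j)%R -> S i j = 0).

Definition lseries1 : lseries := fun i j => ((i == 0%N) && (j == 0))%:R.

(* t^a L^b S *)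
Definition mulTL (a : nat) (b : int) (S : lseries) : lseries :=
  fun i j => if (a <= i)%N then S (i - a)%N (j - b) else 0.

(* The product of S with a polynomial p in t, L and the lambdas. *)
Definition mulP (p : lpoly) (S : lseries) : lseries :=
  fun i j => \sum_(m <- msupp p)
    ((\prod_(l <- finsupp m | (1 < l)%N) pvar l ^+ m l)
       * mulTL (m 0%N) (m 1%N)%:Z S i j) *~ p@_m.

(* S is the expansion of x = p / q: q S = p. *)
Definition expansion (x : ratfun) (S : lseries) : Prop :=
  exists p q : lpoly,
    [/\ q != 0, x = frac_of p / frac_of q & mulP q S =2 mulP p lseries1].

(* S = sum_(m > k) F m, each coefficient of t^i converging L^-1-adically:
   the partial sums eventually agree with S in all degrees >= N in L.         *)
Definition sum_above (k : nat) (F : nat -> lseries) (S : lseries) : Prop :=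
  forall (i : nat) (N : int), exists M : nat, forall n : nat, (M <= n)%N ->
  forall j : int, (N <= j)%R -> \sum_(k.+1 <= m < n) F m i j = S i j.

(* Only the entries with positive indices are meaningful. *)
Record G_family (G : nat -> nat -> lseries) : Prop := {
  G_lseries : forall k m, (0 < k)%N -> (0 < m)%N -> is_lseries (G k m);
  G_11 : G 1%N 1%N =2 mulTL 0 (- 2) (mulP ((pvar 1 - 1) ^+ 2) lseries1);
  G_sym : forall k m, (0 < k)%N -> (0 < m)%N -> G k m =2 G m k;
  G_lt : forall k m, (0 < k)%N -> (k < m)%N ->
    G k m =2 mulTL (k * (k - 1)) (- k%:Z) (G k (m - k)%N);
  G_diag : forall k, (0 < k)%N -> exists2 S : lseries,
    is_lseries S /\ sum_above k (G k) S & G k k =2 mulP (pvar k - 1) S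
}.

Definition Hcoef (G : nat -> nat -> ratfun) (k m : nat) : ratfun :=
  at_t1 (G k m) / all_lam_to_L (at_t1 (G k m)).

(* Power series in a, b are given by their coefficients: Hgen G u v is the
   coefficient of a^u b^v in H, and Hpow G al u v the one in
   H(a^al, b^al, L^al; lambda_(2 al), lambda_(3 al), ...).                    *)
Definition Hgen (G : nat -> nat -> ratfun) (u v : nat) : ratfun :=
  if (0 < u)%N && (0 < v)%N then Hcoef G u v else 0.

Definition Hpow (G : nat -> nat -> ratfun) (al u v : nat) : ratfun :=
  if [&& (0 < u)%N, (0 < v)%N, (al %| u)%N & (al %| v)%N]
  then adams al (Hcoef G (u %/ al) (v %/ al)) else 0.

(* The derivative of order ks 1 in lambda_(al 1), ..., ks n in lambda_(al n). *)
Definition iter_dlam (n : nat) (al ks : nat -> nat) (x : ratfun) : ratfun :=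
  foldr (fun j => iter (ks j) (dlam (al j))) x (iota 1 n).

(* Main.v *)
(* Put t = 1. The Euclidean recursion gives
   G_{k,m} = (L - 1)^2 L^(-k-m) h_{gcd(k,m)}, where h_1 = 1 and, for n >= 2,
     h_n = (lambda_n - 1) / (1 - lambda_n L^-n)
           * sum_{0 < r < n} L^-r h_{gcd(r,n)}.
   For lambda_i = L a geometric sum gives h_n = 1, hence H_{k,m} = h_{gcd(k,m)}.
   In the recursion only h_d with d a proper divisor of n occur, and the r with
   alpha | gcd(r, n) reproduce the recursion for h_{n / alpha} after
   L := L^alpha, lambda_i := lambda_{i alpha}. So (i) follows by induction on n.
   In (i) the last factor is constant in lambda_i for 2 <= i <= alpha, and
   lambda_alpha occurs in h_alpha only through the explicit fraction, so (ii)
   is obtained by differentiating (i) repeatedly.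

   Equality of expansions gives the recursion for the rational functions: a
   rational function is determined by its expansion because p -> p * 1 is
   injective on polynomials, and the tail sum S = sum_{m > k} G_{k,m} satisfies
   L^k S = t^(k(k-1)) (S + G_{k,1} + ... + G_{k,k}). *)
Require Import Defs.
From HB Require Import structures.
From Stdlib Require Import ClassicalEpsilon.
From mathcomp Require Import all_boot all_order all_algebra.
From mathcomp Require Import generic_quotient finmap ring zify.
From mathcomp.multinomials Require Import monalg.

Set Implicit Arguments.
Unset Strict Implicit.
Unset Printing Implicit Defensive.

Import GRing.Theory.
Local Open Scope ring_scope.

Local Notation "1" := (@mone _) : monom_scope.
Local Notation "x * y" := (mmul x y) : monom_scope.

(** * Places and the quotient rule in a field of fractions *)

Section FractionField.

Variables (A : idomainType) (F : fieldType) (f : {rmorphism A -> F}).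
Hypothesis f_inj : injective f.

Lemma fr_eq0 p : (f p == 0) = (p == 0).
Proof. by rewrite -(inj_eq f_inj) rmorph0. Qed.

Lemma fr_div_eq (p q p' q' : A) : q != 0 -> q' != 0 ->
  f p / f q = f p' / f q' -> p * q' = p' * q.
Proof.
move=> q0 q'0 /eqP; rewrite eqr_div ?fr_eq0 // -!rmorphM => /eqP.
exact: f_inj.
Qed.

(** For a ring morphism [s] this is the graph of its extension to the localization of [A] at the
    kernel of [s]; it is the relation under the [epsilon] in [fsubst]. *)
Definition place (s : A -> A) (x y : F) : Prop := exists p q : A,
  [/\ s q != 0, x = f p / f q & y = f (s p) / f (s q)].

Section Place.

Variable s : {rmorphism A -> A}.

Lemma place_neq0 q : s q != 0 -> q != 0.
Proof. by apply: contraNneq => ->; rewrite rmorph0. Qed.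

Lemma place_fun x y y' : place s x y -> place s x y' -> y = y'.
Proof.
move=> [p [q [sq Ex ->]]] [p' [q' [sq']]]; rewrite Ex => E ->.
have := fr_div_eq (place_neq0 sq) (place_neq0 sq') E.
move/(congr1 (f \o s)) => /=; rewrite !rmorphM /= => E'.
by apply/eqP; rewrite eqr_div ?fr_eq0 // E'.
Qed.

Lemma place_of p : place s (f p) (f (s p)).
Proof. by exists p, 1; rewrite !rmorph1 !divr1 oner_neq0. Qed.

Lemma place0 : place s 0 0.
Proof. by have := place_of 0; rewrite !rmorph0. Qed.

Lemma place1 : place s 1 1.
Proof. by have := place_of 1; rewrite !rmorph1. Qed.

Lemma placeD x y x' y' :
  place s x y -> place s x' y' -> place s (x + x') (y + y').
Proof.
move=> [p [q [sq -> ->]]] [p' [q' [sq' -> ->]]].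
have [q0 q'0] := (place_neq0 sq, place_neq0 sq').
exists (p * q' + p' * q), (q * q').
rewrite rmorphM mulf_neq0 //; split=> //.
  by rewrite addf_div ?fr_eq0 // !(rmorphM, rmorphD).
by rewrite addf_div ?fr_eq0 // !(rmorphM, rmorphD).
Qed.

Lemma placeN x y : place s x y -> place s (- x) (- y).
Proof.
by move=> [p [q [sq -> ->]]]; exists (- p), q; rewrite !rmorphN !mulNr.
Qed.

Lemma placeB x y x' y' :
  place s x y -> place s x' y' -> place s (x - x') (y - y').
Proof. by move=> h /placeN; apply: placeD. Qed.

Lemma placeM x y x' y' :
  place s x y -> place s x' y' -> place s (x * x') (y * y').
Proof.
move=> [p [q [sq -> ->]]] [p' [q' [sq' -> ->]]].
exists (p * p'), (q * q').
by rewrite !rmorphM mulf_neq0 //= !mulf_div.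
Qed.

Lemma placeX n x y : place s x y -> place s (x ^+ n) (y ^+ n).
Proof.
move=> h; elim: n => [|n IH]; first by rewrite !expr0; apply: place1.
by rewrite !exprS; apply: placeM.
Qed.

Lemma placeV x y : place s x y -> y != 0 -> place s x^-1 y^-1.
Proof.
move=> [p [q [sq -> ->]]] y0; exists q, p; rewrite !invf_div; split=> //.
by apply: contraNneq y0 => ->; rewrite rmorph0 mul0r.
Qed.

Lemma place_div x y x' y' :
  place s x y -> place s x' y' -> y' != 0 -> place s (x / x') (y / y').
Proof. by move=> h h' y0; apply: placeM h (placeV h' y0). Qed.

Lemma place_sum (I : Type) (r : seq I) (P : pred I) (g h : I -> F) :
  (forall i, P i -> place s (g i) (h i)) ->
  place s (\sum_(i <- r | P i) g i) (\sum_(i <- r | P i) h i).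
Proof.
move=> gh; elim/big_rec2: _ => [|i x y Pi]; first exact: place0.
exact/placeD/gh.
Qed.

End Place.

Section QuotientRule.

Variable D : A -> A.
Hypothesis DD : {morph D : p q / p + q}.
Hypothesis DM : forall p q, D (p * q) = D p * q + p * D q.

Definition quot_rule p q : F := f (D p * q - p * D q) / f q ^+ 2.

(** Differentiating [p * q' = p' * q] relates the four derivatives. Hence the quotient rule may be
    computed on any representative of a fraction. *)
Lemma quot_rule_eq p q p' q' : q != 0 -> q' != 0 -> f p / f q = f p' / f q' ->
  quot_rule p q = quot_rule p' q'.
Proof.
move=> q0 q'0 /(fr_div_eq q0 q'0) E; rewrite /quot_rule.
have E' : D p * q' + p * D q' = D p' * q + p' * D q by rewrite -!DM E.
apply/eqP; rewrite eqr_div ?expf_neq0 ?fr_eq0 // -!rmorphXn -!rmorphM.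
apply/eqP; congr (f _).
(* The left side is written through [D (p * q')] and [p * q'], the two quantities that [E'] and [E]
   replace. *)
transitivity (((D p * q' + p * D q') * q - p * q' * D q) * q'
              - p * q' * q * D q'); first by ring.
by rewrite E' E; ring.
Qed.

Variable d : F -> F.
Hypothesis dE : forall p q, q != 0 -> d (f p / f q) = quot_rule p q.
Hypothesis f_surj : forall x, exists p q, q != 0 /\ x = f p / f q.

Lemma quot_ruleD : {morph d : x y / x + y}.
Proof.
move=> x y; have [p [q [q0 ->]]] := f_surj x.
have [p' [q' [q'0 ->]]] := f_surj y.
rewrite addf_div ?fr_eq0 // -!rmorphM -rmorphD !dE ?mulf_neq0 //.
have fq0 : f q != 0 by rewrite fr_eq0.
have fq'0 : f q' != 0 by rewrite fr_eq0.
rewrite /quot_rule !DD !DM !(rmorphB, rmorphD, rmorphM) /=.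
by field; rewrite fq0 fq'0.
Qed.

Lemma quot_ruleM x y : d (x * y) = d x * y + x * d y.
Proof.
have [p [q [q0 ->]]] := f_surj x; have [p' [q' [q'0 ->]]] := f_surj y.
rewrite mulf_div -!rmorphM !dE ?mulf_neq0 //.
have fq0 : f q != 0 by rewrite fr_eq0.
have fq'0 : f q' != 0 by rewrite fr_eq0.
rewrite /quot_rule !DM !(rmorphB, rmorphD, rmorphM) /=.
by field; rewrite fq0 fq'0.
Qed.

Lemma quot_rule_of p : d (f p) = f (D p).
Proof.
have D1 : D 1 = 0.
  by have /eqP := DM 1 1; rewrite !mulr1 mul1r addrC -subr_eq subrr => /eqP <-.
rewrite -[f p]divr1 -(rmorph1 f) dE ?oner_neq0 // /quot_rule D1 !mulr1 mulr0.
by rewrite subr0 rmorph1 expr1n divr1.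
Qed.

End QuotientRule.

End FractionField.

(** * The numbers h_n and their derivatives *)

Lemma sum_multiples (V : nmodType) (a m : nat) (E : nat -> V) : (0 < a)%N ->
  \sum_(1 <= r < (m * a)%N | (a %| r)%N) E r = \sum_(1 <= s < m) E (s * a)%N.
Proof.
move=> a0; elim: m => [|[|m] IH]; first by rewrite !big_geq ?mul0n.
  rewrite mul1n [RHS]big_geq // big1_seq // => r /andP[/dvdnP[[|k] ->]].
    by rewrite mem_index_iota.
  by rewrite mem_index_iota mulSn => /andP[_]; rewrite ltnNge leq_addr.
rewrite big_nat_recr //= -IH (@big_cat_nat _ _ _ (m.+1 * a)) /=; try lia.
(* Between [m.+1 * a] and the next multiple of [a] no index satisfies the condition, so only one
   term is added. *)
congr (_ + _); rewrite big_ltn_cond ?ltn_pmul2r // dvdn_mull //.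
rewrite big1_seq ?addr0 // => r /andP[/dvdnP[k ->]].
by rewrite mem_index_iota !ltn_pmul2r // ltnS andbC ltnNge; case: (k <= _)%N.
Qed.

Section NormalizedCoefficients.

Variables (F : fieldType) (L : F) (lam : nat -> F).

(** The recursion goes to gcds and is not structural, so [n] serves as fuel. With [0 < d <= n] it
    never runs out, because each call passes to a proper divisor. *)
Fixpoint hrec (n d : nat) : F :=
  if n is n'.+1 then
    if (d <= 1)%N then 1
    else (lam d - 1) / (1 - lam d * L ^- d) *
         \sum_(1 <= r < d) L ^- r * hrec n' (gcdn r d)
  else 1.

Definition hval (d : nat) : F := hrec d d.

Lemma gcdn_lt r d : (0 < r < d)%N -> (0 < gcdn r d < d)%N.
Proof.
move=> /andP[r0 rd]; rewrite gcdn_gt0 r0 /=.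
by apply: leq_ltn_trans rd; apply: dvdn_leq (dvdn_gcdl _ _).
Qed.

Lemma hrec_stable n d : (d <= n)%N -> hrec n d = hval d.
Proof.
rewrite /hval; elim/ltn_ind: d n => d IH [|n]; first by case: d IH.
case: d IH => [|d] IH //= dn; case: ifP => // _; congr (_ * _).
rewrite !big_nat; apply: eq_bigr => r /gcdn_lt /andP[g0 gd]; congr (_ * _).
by rewrite !(IH _ gd) //; lia.
Qed.

Lemma hval_small d : (d <= 1)%N -> hval d = 1.
Proof. by case: d => [|[]]. Qed.

Lemma hvalE d : (1 < d)%N ->
  hval d = (lam d - 1) / (1 - lam d * L ^- d) *
           \sum_(1 <= r < d) L ^- r * hval (gcdn r d).
Proof.
case: d => // d d1; rewrite {1}/hval /= leqNgt d1 /=; congr (_ * _).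
rewrite !big_nat; apply: eq_bigr => r /gcdn_lt /andP[_ gd].
by rewrite hrec_stable //; lia.
Qed.

End NormalizedCoefficients.

(** * Derivations of a field *)

Definition is_derivation (F : fieldType) (d : F -> F) : Prop :=
  {morph d : x y / x + y} /\ forall x y, d (x * y) = d x * y + x * d y.

Section Derivation.

Variables (F : fieldType) (d : F -> F).
Hypothesis dder : is_derivation d.

Lemma derD x y : d (x + y) = d x + d y. Proof. exact: dder.1. Qed.
Lemma derM x y : d (x * y) = d x * y + x * d y. Proof. exact: dder.2. Qed.

Lemma der0 : d 0 = 0.
Proof.
by apply/eqP; have /eqP := derD 0 0; rewrite addr0 -subr_eq subrr eq_sym.
Qed.

Lemma der1 : d 1 = 0.
Proof.
by apply/eqP; have /eqP := derM 1 1; rewrite !mulr1 mul1r -subr_eq subrr eq_sym.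
Qed.

Lemma derN x : d (- x) = - d x.
Proof. by apply/eqP; rewrite -addr_eq0 -derD addNr der0. Qed.

Lemma derB x y : d (x - y) = d x - d y.
Proof. by rewrite derD derN. Qed.

Lemma derMl c x : d c = 0 -> d (c * x) = c * d x.
Proof. by rewrite derM => ->; rewrite mul0r add0r. Qed.

Lemma der_sum (I : Type) (r : seq I) (P : pred I) (g : I -> F) :
  d (\sum_(i <- r | P i) g i) = \sum_(i <- r | P i) d (g i).
Proof. by apply: big_morph; [exact: derD | exact: der0]. Qed.

Lemma derV x : d x^-1 = - d x / x ^+ 2.
Proof.
have [->|x0] := eqVneq x 0; first by rewrite invr0 der0 oppr0 mul0r.
apply: (mulfI x0); have /eqP := derM x x^-1; rewrite divff // der1 eq_sym.
by rewrite addrC addr_eq0 => /eqP ->; field.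
Qed.

Lemma derX n x : d (x ^+ n) = x ^+ n.-1 * d x *+ n.
Proof.
elim: n => [|[|n] IH]; first by rewrite der1 mulr0n.
  by rewrite expr1 mul1r.
rewrite exprS derM IH /= mulrnAr [in RHS]mulrS mulrA -exprS.
by rewrite mulrC.
Qed.

Lemma der_natr n : d n%:R = 0.
Proof. by elim: n => [|n IH]; rewrite ?der0 // mulrS derD der1 IH addr0. Qed.

Lemma der_constM x y : d x = 0 -> d y = 0 -> d (x * y) = 0.
Proof. by rewrite derM => -> ->; rewrite mulr0 mul0r addr0. Qed.

Lemma der_constV x : d x = 0 -> d x^-1 = 0.
Proof. by rewrite derV => ->; rewrite oppr0 mul0r. Qed.

Lemma der_constX n x : d x = 0 -> d (x ^+ n) = 0.
Proof. by rewrite derX => ->; rewrite mulr0 mul0rn. Qed.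

Lemma der_constB x y : d x = 0 -> d y = 0 -> d (x - y) = 0.
Proof. by rewrite derB => -> ->; rewrite subr0. Qed.

Lemma der_const_prod (I : Type) (r : seq I) (P : pred I) (g : I -> F) :
  (forall i, P i -> d (g i) = 0) -> d (\prod_(i <- r | P i) g i) = 0.
Proof.
by move=> g0; elim/big_rec: _ => [|i x Pi]; [apply: der1 | apply/der_constM/g0].
Qed.

Lemma iter_der0 k : iter k d 0 = 0.
Proof. by elim: k => //= k ->; rewrite der0. Qed.

Lemma iter_derMl k c x : d c = 0 -> iter k d (c * x) = c * iter k d x.
Proof. by move=> dc; elim: k => //= k ->; rewrite derMl. Qed.

(** Every [gcdn r n] divides [n], so besides L only the [lam e] with [1 < e] and [e %| n] enter. *)
Lemma der_hval_const (L : F) (lam : nat -> F) n : d L = 0 ->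
  (forall e, (1 < e)%N -> (e %| n)%N -> d (lam e) = 0) -> (0 < n)%N ->
  d (hval L lam n) = 0.
Proof.
move=> dL; elim/ltn_ind: n => n IH dlam n0.
case: (leqP n 1) => n1; first by rewrite hval_small // der1.
have dLn r : d (L ^- r) = 0 by apply/der_constV/der_constX.
have dl := dlam n n1 (dvdnn n).
rewrite hvalE //; apply: der_constM.
  apply: der_constM; first by apply: der_constB => //; exact: der1.
  by apply/der_constV/der_constB; [exact: der1 | apply: der_constM].
rewrite der_sum big_nat big1 // => r /gcdn_lt /andP[g0 gn].
apply/der_constM/IH => // e e1 eg; apply: dlam => //.
exact: dvdn_trans eg (dvdn_gcdr _ _).
Qed.

End Derivation.

(** * Derivatives of h_n in the lambdas *)

Section Differentiation.

Variables (F : fieldType) (lam : nat -> F) (dl : nat -> F -> F).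
Hypothesis dl_der : forall i, is_derivation (dl i).
Hypothesis dl_lam : forall i j, (0 < j)%N -> dl i (lam j) = (i == j)%:R.
Hypothesis L_neq0 : lam 1 != 0.
Hypothesis lam_neq1 : forall k, (1 < k)%N -> lam k - 1 != 0.
Hypothesis lam_neqL : forall k, (1 < k)%N -> 1 - lam k * lam 1 ^- k != 0.

Local Notation L := (lam 1).
Local Notation h := (hval L lam).
(** The image of h under L := L^a, lambda_i := lambda_(i a). At index 1 the sequence has [lam a]
    rather than L^a, but [hval] reads it only from index 2 on. *)
Definition hadams a := hval (lam 1 ^+ a) (fun i => lam (i * a)%N).

Lemma dl_L i : (1 < i)%N -> dl i L = 0.
Proof. by rewrite dl_lam //; case: i => [|[]]. Qed.

Lemma dl_Ln i r : (1 < i)%N -> dl i (L ^- r) = 0.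
Proof. by move=> i1; apply/der_constV/der_constX/dl_L. Qed.

(** Besides L, the variables involved are [lam (e * a)] with [e >= 2], and [e * a > a >= i]. *)
Lemma dl_hadams i a n : (1 < i <= a)%N -> (0 < n)%N -> dl i (hadams a n) = 0.
Proof.
move=> /andP[i1 ia] n0; apply: der_hval_const => //.
  exact/der_constX/dl_L.
move=> e e1 _; rewrite dl_lam; last by rewrite muln_gt0; lia.
suff /negPf-> : i != (e * a)%N by []; nia.
Qed.

(** For [0 < k]: the k-th derivative of (x - 1) / (1 - x u) in x = [lam a], with u = L^-a, divided
    by that fraction itself. *)
Definition hfactor a k : F :=
  (1 - L ^- a) * (k`!%:R * L ^- (a * (k - 1)))
    / ((lam a - 1) * (1 - lam a * L ^- a) ^+ k).

Lemma dl_hfactor i a k : (1 < i < a)%N -> dl i (hfactor a k) = 0.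
Proof.
move=> /andP[i1 ia]; have dLn r := @dl_Ln i r i1.
have d1 := der1 (dl_der i).
have dla : dl i (lam a) = 0 by rewrite dl_lam ?(ltn_eqF ia) //; lia.
apply: der_constM => //; [|apply/der_constV => //]; apply: der_constM => //.
- exact: der_constB.
- by apply: der_constM => //; apply: der_natr.
- exact: der_constB.
- by apply/der_constX => //; apply/der_constB => //; apply: der_constM.
Qed.

(** If [a] does not divide [n], lambda_a does not occur in h_n. If [a] is a proper divisor, it
    occurs only in the sum, where induction applies. If [n = a], it occurs only in the leading
    fraction. *)
Lemma dl_hval a n : (1 < a)%N -> (0 < n)%N ->
  dl a (h n) =
  if (a %| n)%N then hfactor a 1 * h a * hadams a (n %/ a) else 0.
Proof.
move=> a1; have a0 : (0 < a)%N by lia.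
have dD := derD (dl_der a); have dM := derM (dl_der a).
elim/ltn_ind: n => n IH n0; case: ifP => [/dvdnP[m E]|/negP na]; last first.
  apply: der_hval_const => //; first exact: dl_L.
  move=> e e1 en; rewrite dl_lam; last by lia.
  by case: eqP => // E; case: na; rewrite E.
rewrite E mulnK //; have m0 : (0 < m)%N by move: n0; rewrite E; case: (m).
have n1 : (1 < n)%N by nia.
have dLn r := @dl_Ln a r a1.
case: (ltngtP m 1) => m1; first by lia.
  have dln : dl a (lam n) = 0.
    by rewrite dl_lam; [case: eqP => // ?; nia | lia].
  rewrite -E hvalE // (derMl (dl_der a)); last first.
    apply: der_constM => //; first by apply: der_constB => //; apply: der1.
    apply/der_constV/der_constB => //; first exact: der1.
    exact: der_constM.
  rewrite der_sum //.
  (* The leading fraction of h_n times this sum is [hadams a m], by the recursion at [m]: (L^a)^m =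
     L^n and [lam (m * a)] is [lam n]. *)
  transitivity ((lam n - 1) / (1 - lam n / L ^+ n) * (hfactor a 1 * h a *
     \sum_(1 <= s < m) L ^+ a ^- s * hadams a (gcdn s m))); last first.
    by rewrite [hadams a m](hvalE _ _ m1) -exprM [(a * m)%N]mulnC -E; ring.
  congr (_ * _); rewrite mulr_sumr.
  (* The induction hypothesis kills the terms with [a] not dividing [r]; [sum_multiples] reindexes
     the others. *)
  transitivity (\sum_(1 <= r < (m * a)%N | (a %| r)%N)
     hfactor a 1 * h a * (L ^- r * hadams a (gcdn r n %/ a))).
    rewrite -E [RHS]big_mkcond !big_nat /=.
    apply: eq_bigr => r rn; have /andP[g0 gn] := gcdn_lt rn.
    rewrite (derMl (dl_der a)) // IH // dvdn_gcd E dvdn_mull // andbT.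
    by case: ifP => _; [ring | rewrite mulr0].
  rewrite sum_multiples //; apply: eq_bigr => s _.
  by rewrite E -muln_gcdl mulnK // [(s * a)%N]mulnC exprM.
(* Now [n = a]: the sum [X] involves h only at proper divisors of [a], so the fraction alone is
   differentiated. *)
rewrite m1 mul1n [hadams a 1]hval_small // mulr1.
rewrite hvalE // /hfactor (factS 0) fact0 subnn muln0 expr0 invr1 !mul1r !expr1.
set X := \sum_(_ <= _ < _) _.
have dX : dl a X = 0.
  rewrite der_sum // big_nat big1 // => r /gcdn_lt /andP[g0 ga].
  apply/der_constM => //; apply: der_hval_const => //; first exact: dl_L.
  move=> e e1 eg; rewrite dl_lam; last by lia.
  have := dvdn_leq g0 eg; case: eqP => // <-; lia.
have l0 := lam_neq1 a1; have l1 := lam_neqL a1.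
have La0 : L ^+ a != 0 by rewrite expf_neq0.
have dB := derB (dl_der a); have dV := derV (dl_der a).
have d1 := der1 (dl_der a).
rewrite dM dX mulr0 addr0 dM dV !dB dM dLn d1 dl_lam //.
rewrite eqxx /=; move: (L ^- a) l1 => u l1.
by field; rewrite l0 l1.
Qed.

(** In the first derivative [hadams] is constant and [lam a - 1] cancels between [hfactor] and h_a.
    Each further derivative acts on a negative power of 1 - lambda_a L^-a, which produces the
    factorial and the powers of L^-a. *)
Lemma iter_dl_hval a k n : (1 < a)%N -> (0 < k)%N -> (0 < n)%N ->
  iter k (dl a) (h n) =
  if (a %| n)%N then hfactor a k * h a * hadams a (n %/ a) else 0.
Proof.
move=> a1 + n0; case: k => // k _; have a0 : (0 < a)%N by lia.
elim: k => [|k IH]; first exact: dl_hval.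
rewrite iterS IH; case: ifP => an; last exact: der0.
have m0 : (0 < n %/ a)%N by rewrite divn_gt0 // dvdn_leq.
have l0 := lam_neq1 a1; have l1 := lam_neqL a1.
have La0 : L ^+ a != 0 by rewrite expf_neq0.
rewrite !(mulrC _ (hadams _ _)) (derMl (dl_der a)) ?dl_hadams ?a1 ?leqnn //.
congr (_ * _).
rewrite hvalE // /hfactor !subn1 /=; set X := \sum_(_ <= _ < _) _.
have dX : dl a X = 0.
  rewrite der_sum // big_nat big1 // => r /gcdn_lt /andP[g0 ga].
  apply/der_constM; [done|exact: dl_Ln|].
  by rewrite dl_hval // gtnNdvd.
(* The part of [hfactor a k.+1 * h a] that is free of lambda_a, once [lam a - 1] has cancelled. *)
pose c : F := (1 - L ^- a) * (k.+1`!%:R * L ^- (a * k)) * X.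
have dc : dl a c = 0.
  have dLn r := @dl_Ln a r a1; apply: der_constM => //; apply: der_constM => //.
    exact: der_constB (der1 _) _.
  by apply: der_constM => //; apply: der_natr.
have Lk0 : L ^+ (a * k) != 0 by rewrite expf_neq0.
transitivity (dl a (c * ((1 - lam a * L ^- a) ^+ k.+2)^-1)).
  congr (dl a _); rewrite /c [_ ^+ k.+2]exprS.
  have : (1 - lam a * L ^- a) ^+ k.+1 != 0 by rewrite expf_neq0.
  move: (_ ^+ k.+1) => y y0; move: (L ^- a) l1 => u l1.
  by field; rewrite y0 l1 Lk0 l0.
rewrite (derMl (dl_der a)) // (derV (dl_der a)) (derX (dl_der a)).
rewrite (derB (dl_der a)) (der1 (dl_der a)) (derM (dl_der a)) dl_Ln // dl_lam //.
rewrite eqxx mul1r mulr0 addr0 sub0r /= /c [k.+2`!]factS natrM.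
rewrite mulnS exprD [(_ * L ^+ (a * k))^-1]invfM.
have : (1 - lam a * L ^- a) ^+ k != 0 by rewrite expf_neq0.
rewrite ![_ ^+ k.+2]exprS ![_ ^+ k.+1]exprS -mulr_natl.
move: (_ ^+ k) => y y0; move: (L ^- a) l1 => u l1.
by field; rewrite l1 y0 l0 Lk0.
Qed.

(* With [i] the first index, the derivatives in the variables of index [> i]
   leave [hval (al i.+1)] times a factor which is constant in [lam (al i)]. *)
Lemma iter_dl_chain (al ks : nat -> nat) (N i n : nat) : (0 < N)%N ->
  (1 < al i)%N ->
  (forall j, (i <= j < i + n)%N -> (al j < al j.+1)%N) ->
  (forall j, (i <= j <= i + n)%N -> (0 < ks j)%N) ->
  foldr (fun j => iter (ks j) (dl (al j))) (h N) (iota i n.+1) =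
  if all (fun j => al j %| al j.+1)%N (iota i n) && (al (i + n) %| N)%N then
    (\prod_(i <= j < (i + n).+1) hfactor (al j) (ks j)) * h (al i) *
    (\prod_(i.+1 <= j < (i + n).+1) hadams (al j.-1) (al j %/ al j.-1)) *
    hadams (al (i + n)%N) (N %/ al (i + n)%N)
  else 0.
Proof.
move=> N0; elim: n i => [|n IH] i ali mono ksp.
  rewrite /= !addn0 iter_dl_hval //; last by apply: ksp; rewrite addn0 leqnn.
  by rewrite big_nat1 [\prod_(i.+1 <= j < i.+1) _]big_geq // mulr1.
have ii1 : (al i < al i.+1)%N by apply: mono; lia.
transitivity (iter (ks i) (dl (al i))
  (foldr (fun j => iter (ks j) (dl (al j))) (h N) (iota i.+1 n.+1))) => //.
rewrite IH //; first last.
- by move=> j hj; apply: ksp; lia.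
- by move=> j hj; apply: mono; lia.
- exact: ltn_trans ii1.
rewrite addSnnS [iota i n.+1]/= [all _ (_ :: _)]/= -andbA.
have ki : (0 < ks i)%N by apply: ksp; lia.
have i1gt : (0 < al i.+1)%N by lia.
have al_lt j : (i < j <= i + n.+1)%N -> (al i < al j)%N.
  elim: j => [|j IHj]; first by lia.
  case: (eqVneq i j) => [<- //|ij hj].
  by apply: ltn_trans (IHj _) (mono _ _); lia.
(* A divisibility that fails further along the chain already gives 0, and derivatives of 0 stay
   0. *)
case: ifP => [/andP[_ alN]|_]; last by rewrite iter_der0 // andbF.
rewrite andbT; have ali_last : (al i < al (i + n.+1))%N by apply: al_lt; lia.
set c := \prod_(i.+1 <= j < _) _; set e := \prod_(i.+2 <= j < _) _.
set b := hadams _ _.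
have dc : dl (al i) c = 0.
  rewrite /c big_nat; apply: der_const_prod => // j hj.
  by rewrite dl_hfactor // ali al_lt //; lia.
have de : dl (al i) e = 0.
  rewrite /e big_nat; apply: der_const_prod => // j hj.
  have lt1 : (al i < al j.-1)%N by apply: al_lt; lia.
  have lt2 : (al j.-1 < al j)%N by rewrite -{2}[j]prednK ?mono //; lia.
  by rewrite dl_hadams ?ali ?(ltnW lt1) // divn_gt0 ?(ltnW lt2) //; lia.
have db : dl (al i) b = 0.
  rewrite dl_hadams ?ali ?(ltnW ali_last) // divn_gt0; last by lia.
  exact: dvdn_leq.
(* Only h at [al i.+1] depends on [lam (al i)]. Its iterated derivative supplies [hfactor], h at
   [al i] and the [hadams] factor joining [al i] to [al i.+1], or 0 if [al i] does not divide
   [al i.+1]. *)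
rewrite (_ : c * _ * e * b = c * e * b * h (al i.+1)); last by ring.
rewrite iter_derMl //; last by do 2?apply: der_constM.
rewrite iter_dl_hval //; case: ifP => [dv|_]; last by rewrite mulr0.
rewrite [in RHS]big_ltn; last by lia.
rewrite [X in _ = _ * X * _]big_ltn; last by lia.
by rewrite -/c -/e -/b /=; ring.
Qed.
End Differentiation.

(** * Values of G at t = 1 *)

Lemma sum_geom_inv (F : fieldType) (L : F) (n : nat) : L != 0 ->
  (L - 1) * (\sum_(1 <= r < n.+1) L ^- r) = 1 - L ^- n.
Proof.
move=> L0; elim: n => [|n IH]; first by rewrite big_geq // invr1 subrr mulr0.
rewrite big_nat_recr //= mulrDr IH exprS.
by field; rewrite L0 expf_neq0.
Qed.

(** By induction the sum becomes geometric, and L - 1 times it is 1 - L^(1-n), the denominator of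
    the leading fraction. *)
Lemma hval_specialized (F : fieldType) (L : F) (n : nat) : L != 0 ->
  (forall k, (0 < k)%N -> L ^+ k != 1) -> hval L (fun=> L) n = 1.
Proof.
move=> L0 L1; elim/ltn_ind: n => n IH.
case: (leqP n 1) => n1; first by rewrite hval_small.
rewrite hvalE // big_nat.
under eq_bigr => r /gcdn_lt /andP[_ gn] do rewrite IH // mulr1.
rewrite -big_nat; case: n n1 {IH} => // n n1.
rewrite mulrAC sum_geom_inv // exprS invfM mulVKf // divff //.
rewrite subr_eq0 eq_sym -(inj_eq invr_inj) invr1 invrK L1 //; lia.
Qed.

Section Values.

Variables (A : idomainType) (F : fieldType) (f : {rmorphism A -> F}).
Hypothesis f_inj : injective f.

Lemma place_nz (s : {rmorphism A -> A}) x y : place f s x y -> y != 0 -> x != 0.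
Proof.
move=> xy; apply: contraNneq => x0; apply/eqP; rewrite x0 in xy.
exact: (place_fun f_inj) xy (place0 f s).
Qed.

(** The recursion inverts only powers of L and the [1 - lam k * L ^- k], so h_n is regular as soon
    as their images are nonzero. This serves both lambda_i := L and the Adams substitution. *)
Lemma place_hval (s : {rmorphism A -> A}) (L L' : F) (lam lam' : nat -> F) n :
  place f s L L' -> (forall k, (1 < k)%N -> place f s (lam k) (lam' k)) ->
  L' != 0 -> (forall k, (1 < k)%N -> 1 - lam' k * L' ^- k != 0) ->
  place f s (hval L lam n) (hval L' lam' n).
Proof.
move=> pL plam L0 l0; elim/ltn_ind: n => n IH.
case: (leqP n 1) => n1; first by rewrite !hval_small //; apply: place1.
have pLr r : place f s (L ^- r) (L' ^- r).
  by apply: placeV (expf_neq0 _ L0); apply: placeX.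
have p1 := place1 f s.
rewrite !hvalE //; apply: placeM.
  apply: place_div (l0 n n1); first exact: (placeB f_inj) (plam n n1) p1.
  exact: (placeB f_inj) p1 (placeM (plam n n1) (pLr n)).
rewrite !big_nat; apply: (place_sum f_inj) => r /gcdn_lt /andP[_ gn].
exact: placeM (pLr r) (IH _ gn).
Qed.

Variables (X : nat -> A) (G : nat -> nat -> F).

Local Notation lam := (fun i => f (X i)).
Local Notation t := (f (X 0)).
Local Notation L := (f (X 1)).
Local Notation h := (hval L lam).

Hypothesis L_neq0 : L != 0.
Hypothesis lam_neqL : forall k, (1 < k)%N -> L ^+ k - lam k != 0.
Hypothesis L_ord : forall k, (0 < k)%N -> L ^+ k != 1.

Hypothesis G11 : f (X 1 ^+ 2) * G 1 1 = f ((X 1 - 1) ^+ 2).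
Hypothesis Gsym : forall k m, (0 < k)%N -> (0 < m)%N -> G k m = G m k.
Hypothesis Glt : forall k m, (0 < k)%N -> (k < m)%N ->
  f (X 1 ^+ k) * G k m = f (X 0 ^+ (k * (k - 1))) * G k (m - k)%N.
Hypothesis Gdiag : forall k, (0 < k)%N ->
  f (X 1 ^+ k) * G k k = f (X 0 ^+ (k * (k - 1))) *
    (G k k + f (X k - 1) * \sum_(1 <= r < k.+1) G k r).

(** The sum in [Gdiag] contains [G k k] itself at [r = k]; it is collected on the left. *)
Lemma Gdiag_solved k : (1 < k)%N ->
  (L ^+ k - t ^+ (k * (k - 1)) * lam k) * G k k =
  t ^+ (k * (k - 1)) * (lam k - 1) * \sum_(1 <= r < k) G k r.
Proof.
move=> k1; have k0 : (0 < k)%N by lia.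
rewrite mulrBl -(rmorphXn f k) Gdiag // big_nat_recr //=.
by rewrite rmorphB rmorphXn rmorph1; ring.
Qed.

Lemma lam_neqLV k : (1 < k)%N -> 1 - lam k * L ^- k != 0.
Proof.
move=> k1; have Lk0 : L ^+ k != 0 by rewrite expf_neq0.
by rewrite -(divff Lk0) -mulrBl mulf_neq0 ?invr_eq0 ?lam_neqL.
Qed.

Definition Gval k m := (L - 1) ^+ 2 * L ^- (k + m) * h (gcdn k m).

Section AtT1.

Variable s1 : {rmorphism A -> A}.
Hypothesis s1_t : s1 (X 0) = 1.
Hypothesis s1_X : forall i, (0 < i)%N -> s1 (X i) = X i.

Lemma place_t1_lam i : (0 < i)%N -> place f s1 (lam i) (lam i).
Proof. by move=> i0; have := place_of f s1 (X i); rewrite s1_X. Qed.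

(** Subtractive Euclid, by induction on [k + m]; regularity at t = 1 and the value are obtained
    together. *)
Lemma place_t1_G k m : (0 < k)%N -> (0 < m)%N -> place f s1 (G k m) (Gval k m).
Proof.
have pL := @place_t1_lam 1 isT; have p1 := place1 f s1.
have pLX n := placeX n pL.
have pt n : place f s1 (t ^+ n) 1.
  rewrite -(expr1n _ n); apply: placeX.
  by rewrite -[1](rmorph1 f) -s1_t; apply: place_of.
elim/ltn_ind: {k m}(k + m)%N {-2}k {-2}m (erefl (k + m)%N) => n IH k m E k0 m0.
wlog km : k m E k0 m0 / (k <= m)%N.
  move=> W; case: (leqP k m) => [|/ltnW] km; first exact: W.
  by rewrite Gsym // /Gval addnC gcdnC; apply: W; rewrite // addnC.
have L0 := L_neq0; have Ln0 j : L ^+ j != 0 by rewrite expf_neq0.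
case: (ltngtP k m) km => // [km|km] _.
  (* Off the diagonal the power of t becomes 1, and gcd(k, m - k) = gcd(k, m). *)
  have -> : G k m = t ^+ (k * (k - 1)) * G k (m - k)%N / L ^+ k.
    by rewrite -rmorphXn -Glt // rmorphXn mulrC mulKf.
  have -> : Gval k m = 1 * Gval k (m - k) / L ^+ k.
    rewrite /Gval subnKC; last exact: ltnW.
    have -> : gcdn k (m - k) = gcdn k m by rewrite -{2}(subnK (ltnW km)) gcdnDr.
    by rewrite exprD; field; rewrite !Ln0.
  apply: place_div (pLX k) (Ln0 k); apply: placeM (pt _) _.
  by apply: (IH (k + (m - k))%N) => //; lia.
rewrite -km {m E m0 km} in E *; case: (leqP k 1) => k1.
  have -> : k = 1 by lia.
  have -> : G 1 1 = (L - 1) ^+ 2 / L ^+ 2.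
    by rewrite -[1](rmorph1 f) -rmorphB -!rmorphXn -G11 mulrC mulKf // rmorphXn.
  rewrite /Gval hval_small // mulr1.
  apply: place_div (pLX 2) (Ln0 2).
  exact: placeX (placeB f_inj pL p1).
have plk := place_t1_lam k0.
(* The coefficient in [Gdiag_solved] has the nonzero value L^k - lambda_k at t = 1. So it is itself
   nonzero, and dividing by it keeps regularity. *)
have pden : place f s1 (L ^+ k - t ^+ (k * (k - 1)) * lam k)
    (L ^+ k - 1 * lam k).
  exact: (placeB f_inj) (pLX k) (placeM (pt _) plk).
have den0 : L ^+ k - 1 * lam k != 0 by rewrite mul1r lam_neqL.
rewrite -[G k k](mulKf (place_nz pden den0)) Gdiag_solved // mulrC.
have -> : Gval k k = 1 * (lam k - 1) * (\sum_(1 <= r < k) Gval k r)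
    / (L ^+ k - 1 * lam k).
  rewrite /Gval gcdnn hvalE // !mulr_sumr mulr_suml.
  apply: eq_bigr => r _; rewrite gcdnC !exprD.
  rewrite mul1r in den0 *.
  by field; rewrite den0 !Ln0.
apply: place_div pden den0; apply: placeM.
  exact: placeM (pt _) (placeB f_inj plk p1).
rewrite !big_nat; apply: (place_sum f_inj) => r rk.
by apply: (IH (k + r)%N) => //; lia.
Qed.

End AtT1.

Lemma place_L_G (sL : {rmorphism A -> A}) k m :
  (forall i, (0 < i)%N -> sL (X i) = X 1) ->
  place f sL (Gval k m) ((L - 1) ^+ 2 * L ^- (k + m)).
Proof.
move=> sLX; have pl i : (0 < i)%N -> place f sL (lam i) L.
  by move=> i0; have := place_of f sL (X i); rewrite sLX.
have pL := pl 1 isT; have p1 := place1 f sL.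
rewrite -[X in place _ _ _ X]mulr1 /Gval; apply: placeM.
  apply: placeM; first exact: placeX (placeB f_inj pL p1).
  by apply: placeV (expf_neq0 _ _) => //; apply: placeX.
(* Writing 1 as [hval] of the constant sequence L brings the goal to the form of [place_hval]. *)
rewrite -(hval_specialized (gcdn k m) L_neq0 L_ord); apply: place_hval => //.
- by move=> i i1; apply: pl; lia.
- case=> // i i1; rewrite exprS invfM mulVKf // subr_eq0 eq_sym.
  by rewrite -(inj_eq invr_inj) invr1 invrK L_ord.
Qed.

Lemma place_adams_hval (sA : {rmorphism A -> A}) a n : (0 < a)%N ->
  sA (X 1) = X 1 ^+ a -> (forall i, (1 < i)%N -> sA (X i) = X (i * a)%N) ->
  place f sA (h n) (hadams lam a n).
Proof.
move=> a0 sA1 sAX; apply: place_hval.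
- by rewrite -rmorphXn -sA1; apply: place_of.
- by move=> k k1; rewrite -sAX //; apply: place_of.
- by rewrite expf_neq0.
- by move=> k k1; rewrite -exprM mulnC lam_neqLV //; nia.
Qed.

Lemma Gval_ratio k m : Gval k m / ((L - 1) ^+ 2 * L ^- (k + m)) = h (gcdn k m).
Proof.
rewrite /Gval mulrC mulKf // mulf_neq0 ?invr_eq0 ?expf_neq0 //.
by rewrite subr_eq0 -[L]expr1 L_ord.
Qed.

End Values.

(** * The action of polynomials on Laurent series *)

(** Names the monomial map inside [psubst], so that it can carry the multiplicative structure that
    makes [psubst s] a ring morphism. *)
Definition psmon (s : nat -> lpoly) (m : {cmonom nat}) : lpoly :=
  \prod_(i <- finsupp m) s i ^+ m i.

Lemma psmonEw (s : nat -> lpoly) (m : {cmonom nat}) (d : {fset nat}) :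
  (finsupp m `<=` d)%fset -> psmon s m = \prod_(i <- d) s i ^+ m i.
Proof.
move=> le; rewrite /psmon (big_fset_incl _ le) // => i _.
by rewrite -cmE_neq0 negbK => /eqP ->; rewrite expr0.
Qed.

Lemma psmon_morph (s : nat -> lpoly) : mmorphism (psmon s).
Proof.
split=> [m1 m2|]; last by rewrite /psmon mdom1 big_seq_fset0.
rewrite [LHS]/psmon mdomD (psmonEw _ (fsubsetUl _ (finsupp m2))).
rewrite [X in _ * X](psmonEw _ (fsubsetUr (finsupp m1) _)).
by rewrite -big_split /=; apply/eq_bigr=> /= i _; rewrite cmM exprD.
Qed.

HB.instance Definition _ (s : nat -> lpoly) :=
  isMultiplicative.Build {cmonom nat} lpoly (psmon s) (psmon_morph s).

HB.instance Definition _ (s : nat -> lpoly) :=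
  GRing.RMorphism.copy (psubst s) (mmap (intmul 1) (psmon s)).

Lemma psmon_ucm (s : nat -> lpoly) i : psmon s (ucm i) = s i.
Proof. by rewrite /psmon mdomU big_seq_fset1 (ucmE i i) eqxx expr1. Qed.

Lemma psubst_pvar (s : nat -> lpoly) i : psubst s (pvar i) = s i.
Proof. by rewrite /psubst /pvar mmapU mul1r -/(psmon s _) psmon_ucm. Qed.

(** Any monomial other than 1 splits off a variable [ucm i], which lowers its degree. *)
Lemma cmonom_morph_ext (u v : {cmonom nat} -> lpoly) :
  mmorphism u -> mmorphism v -> (forall i, u (ucm i) = v (ucm i)) -> u =1 v.
Proof.
move=> [uM u1] [vM v1] E m; elim/ltn_ind: {m}(mdeg m) {-2}m (erefl (mdeg m)).
move=> n IH m Em; case: (fset_0Vmem (finsupp m)) => [m0|[i im]].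
  by rewrite (@mdeg_eq0I _ m) ?u1 ?v1 // mdegE m0 big_seq_fset0.
have mE : m = (ucm i * divcm m (ucm i))%M.
  apply/eqP/cmP => j; rewrite cmM divcmE ucmE.
  case: eqP => [<-|]; last by rewrite subn0.
  by rewrite subnKC // lt0n cmE_neq0.
rewrite mE uM vM E; congr (_ * _); apply: IH (erefl _).
by rewrite -Em {2}mE mdegM mdegU.
Qed.

Lemma prod_expr_cond (R : comNzRingType) (I : Type) (r : seq I) (P : pred I)
    (x : I -> R) (e : I -> nat) :
  \prod_(i <- r | P i) x i ^+ e i
  = \prod_(i <- r) (if P i then x i else 1) ^+ e i.
Proof.
by rewrite big_mkcond; apply: eq_bigr => i _; case: ifP => // _; rewrite expr1n.
Qed.

Lemma mul3_exp0 (R : comNzRingType) (x y : R) : x ^+ 0 * y ^+ 0 * 1 = 1.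
Proof. by rewrite !mulr1. Qed.

Lemma mul3_proj1 (R : comNzRingType) (x y : R) : x ^+ 1 * y ^+ 0 * 1 = x.
Proof. by rewrite !mulr1. Qed.

Lemma mul3_proj2 (R : comNzRingType) (x y : R) : x ^+ 0 * y ^+ 1 * 1 = y.
Proof. by rewrite mulr1 mul1r. Qed.

Lemma mul3_proj3 (R : comNzRingType) (x y z : R) : x ^+ 0 * y ^+ 0 * z = z.
Proof. by rewrite !mul1r. Qed.

Lemma mul3_expD (R : comNzRingType) (x y z z' : R) a a' b b' :
  x ^+ (a + a') * y ^+ (b + b') * (z * z')
  = (x ^+ a * y ^+ b * z) * (x ^+ a' * y ^+ b' * z').
Proof. by rewrite !exprD; ring. Qed.

Lemma malgU_intmul (K : choiceType) (c : int) (m : K) :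
  << c *g m >> = << m >> *~ c :> {malg int[K]}.
Proof. by have := raddfMz (@mkmalgU K int m) c 1; rewrite intz. Qed.

Lemma sum2_pick (R : comNzRingType) (N a b : nat) (x y z : R) (c : int)
    (E : nat -> nat -> R) : (a < N)%N -> (b < N)%N ->
  (forall i j, E i j = ((i == a) && (j == b))%:R * z) ->
  \sum_(i < N) \sum_(j < N) x ^+ i * y ^+ j * (E i j *~ c)
  = x ^+ a * y ^+ b * z *~ c.
Proof.
move=> aN bN act; rewrite (bigD1 (Ordinal aN)) //= (bigD1 (Ordinal bN)) //=.
rewrite act !eqxx mul1r big1 => [|j jb]; last first.
  rewrite act -[_ == b]/(j == Ordinal bN) (negPf jb) andbF.
  by rewrite mul0r mul0rz mulr0.
rewrite big1 => [|i ia]; first by rewrite !addr0 mulrzAr.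
rewrite big1 // => j _.
by rewrite act -[_ == a]/(i == Ordinal aN) (negPf ia) mul0r mul0rz mulr0.
Qed.

Section LaurentAction.

Implicit Types (p q : lpoly) (S T : lseries) (m : {cmonom nat}).

Definition lam_part m : lpoly :=
  psmon (fun l => if (1 < l)%N then pvar l else 1) m.

Definition mono_act m S : lseries :=
  fun i j => lam_part m * mulTL (m 0%N) (m 1%N)%:Z S i j.

Lemma lam_partE m :
  \prod_(l <- finsupp m | (1 < l)%N) pvar l ^+ m l = lam_part m.
Proof.
exact: prod_expr_cond.
Qed.

Lemma mulPE p S i j :
  mulP p S i j = \sum_(m <- msupp p) mono_act m S i j *~ p@_m.
Proof. by apply: eq_bigr => m _; rewrite lam_partE. Qed.

Lemma mulPEw (d : {fset {cmonom nat}}) p S i j : (msupp p `<=` d)%fset ->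
  mulP p S i j = \sum_(m <- d) mono_act m S i j *~ p@_m.
Proof.
move=> le; rewrite mulPE (big_fset_incl _ le) // => m _ /mcoeff_outdom ->.
exact: mulr0z.
Qed.

Lemma mulPU (c : int) m S i j :
  mulP (<< c *g m >> : lpoly) S i j = mono_act m S i j *~ c.
Proof. by rewrite (mulPEw _ _ _ msuppU_le) big_seq_fset1 mcoeffUU. Qed.

Lemma mulP0 S i j : mulP 0 S i j = 0.
Proof. by rewrite mulPE msupp0 big_seq_fset0. Qed.

Lemma mulPD p q S i j : mulP (p + q) S i j = mulP p S i j + mulP q S i j.
Proof.
rewrite (mulPEw _ _ _ (msuppD_le p q)).
rewrite (mulPEw _ _ _ (fsubsetUl (msupp p) (msupp q))).
rewrite (mulPEw _ _ _ (fsubsetUr (msupp p) (msupp q))) -big_split /=.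
by apply: eq_bigr => m _; rewrite mcoeffD mulrzDr.
Qed.

Lemma mulP_suml (I : Type) (r : seq I) (P : pred I) (p : I -> lpoly) S i j :
  mulP (\sum_(k <- r | P k) p k) S i j = \sum_(k <- r | P k) mulP (p k) S i j.
Proof.
apply: (big_morph (fun p => mulP p S i j)) => [p1 p2|]; first exact: mulPD.
exact: mulP0.
Qed.

Lemma mulTL_comp a b a' b' S :
  mulTL a b (mulTL a' b' S) =2 mulTL (a + a') (b + b') S.
Proof.
move=> i j; rewrite /mulTL; case: (leqP a i) => ai; last first.
  by rewrite leqNgt (leq_trans ai) // leq_addr.
by rewrite leq_subRL // subnDA opprD addrA.
Qed.

Lemma eq_mulTL a b S T : S =2 T -> mulTL a b S =2 mulTL a b T.
Proof. by move=> E i j; rewrite /mulTL; case: ifP. Qed.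

Lemma eq_mono_act m S T : S =2 T -> mono_act m S =2 mono_act m T.
Proof. by move=> E i j; rewrite /mono_act (eq_mulTL _ _ E). Qed.

Lemma mono_actM m m' S : mono_act (m * m')%M S =2 mono_act m (mono_act m' S).
Proof.
move=> i j; rewrite /mono_act /lam_part mmorphM -mulrA !cmM PoszD.
rewrite -mulTL_comp /mulTL; by case: ifP => _; rewrite ?mulr0.
Qed.

Lemma eq_mulP p S T : S =2 T -> mulP p S =2 mulP p T.
Proof.
move=> E i j; rewrite !mulPE; apply: eq_bigr => m _.
by rewrite /mono_act (eq_mulTL _ _ E).
Qed.

Lemma mono_act_sum (I : Type) (r : seq I) (E : I -> lseries) (c : I -> int)
    m i j :
  mono_act m (fun i j => \sum_(k <- r) E k i j *~ c k) i j =
  \sum_(k <- r) mono_act m (E k) i j *~ c k.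
Proof.
rewrite /mono_act /mulTL; case: ifP => _; last first.
  by rewrite mulr0 big1 // => k _; rewrite mul0rz.
by rewrite mulr_sumr; apply: eq_bigr => k _; rewrite mulrzAr.
Qed.

(** Both sides are sums over monomials, where [mono_actM] applies. With [mulP1], [mulPD] and
    [mulP_add], series form a module over the polynomials. *)
Lemma mulPA p q S : mulP (p * q) S =2 mulP p (mulP q S).
Proof.
move=> i j; rewrite {1}[p * q]malgME mulP_suml mulPE; apply: eq_bigr => m _.
rewrite (eq_mono_act m (mulPE q S)).
rewrite mono_act_sum mulP_suml mulrz_suml.
by apply: eq_bigr => k _; rewrite mulPU mono_actM mulrC -mulrzA.
Qed.

Lemma mulPC p q S : mulP p (mulP q S) =2 mulP q (mulP p S).
Proof. by move=> i j; rewrite -!mulPA mulrC. Qed.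

Lemma mulP_add p S T :
  mulP p (fun i j => S i j + T i j) =2 fun i j => mulP p S i j + mulP p T i j.
Proof.
move=> i j; rewrite !mulPE -big_split /=; apply: eq_bigr => m _.
rewrite /mono_act /mulTL; case: ifP => _; last by rewrite mulr0 mul0rz addr0.
by rewrite mulrDr mulrzDl.
Qed.

Lemma mulP_t S : mulP (pvar 0) S =2 mulTL 1 0 S.
Proof.
move=> i j; rewrite /pvar mulPU mulr1z /mono_act /lam_part psmon_ucm mul1r.
by rewrite !ucmE.
Qed.

Lemma mulP_L S : mulP (pvar 1) S =2 mulTL 0 1 S.
Proof.
move=> i j; rewrite /pvar mulPU mulr1z /mono_act /lam_part psmon_ucm mul1r.
by rewrite !ucmE.
Qed.

Lemma mulP1 S : mulP 1 S =2 S.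
Proof.
move=> i j; rewrite -[1 : lpoly]/(<< 1%M >>) mulPU mulr1z /mono_act /lam_part.
by rewrite mmorph1 mul1r !cm1 /mulTL subn0 subr0.
Qed.

Lemma mulP_tX a S : mulP (pvar 0 ^+ a) S =2 mulTL a 0 S.
Proof.
elim: a => [|a IH] i j; first by rewrite mulP1 /mulTL subn0 subr0.
by rewrite exprS mulPA mulP_t (eq_mulTL _ _ IH) mulTL_comp add1n addr0.
Qed.

Lemma mulP_LX k S : mulP (pvar 1 ^+ k) S =2 mulTL 0 k%:Z S.
Proof.
elim: k => [|k IH] i j; first by rewrite mulP1 /mulTL subn0 subr0.
by rewrite exprS mulPA mulP_L (eq_mulTL _ _ IH) mulTL_comp addn0 -PoszD add1n.
Qed.

Lemma pvar_mono m :
  << m >> = pvar 0 ^+ m 0%N * pvar 1 ^+ m 1%N * lam_part m :> lpoly.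
Proof.
apply: (@cmonom_morph_ext (fun m => << m >>)
  (fun m => pvar 0 ^+ m 0%N * pvar 1 ^+ m 1%N * lam_part m)).
- split=> // m1 m2; have := @fgmulUU _ int 1 1 m1 m2.
  by rewrite mulr1 -malgM_def => <-.
- split=> [m1 m2|]; rewrite /lam_part; last first.
    by rewrite mmorph1 !cm1; exact: mul3_exp0.
  by rewrite mmorphM !cmM; exact: mul3_expD.
move=> i; rewrite /lam_part psmon_ucm !ucmE.
case: i => [|[|i]]; apply/esym.
- exact: mul3_proj1.
- exact: mul3_proj2.
- exact: mul3_proj3.
Qed.

(* [p] is recovered from the coefficients of [mulP p lseries1]. *)
Lemma mulP1_eq0 p : (forall i j, mulP p lseries1 i j = 0) -> p = 0.
Proof.
move=> E; rewrite [p]monalgE.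
pose N := (\sum_(m <- msupp p) (m 0%N + m 1%N)).+1%N.
have bound m : m \in msupp p -> (m 0%N < N)%N /\ (m 1%N < N)%N.
  by move=> mp; rewrite /N (big_fsetD1 m) //=; split; lia.
(* [N] exceeds all exponents of t and L in [p]. Multiplying each coefficient, a polynomial in the
   lambdas, back by t^i L^j rebuilds [p]. *)
transitivity (\sum_(i < N) \sum_(j < N)
    pvar 0 ^+ i * pvar 1 ^+ j * mulP p lseries1 i j%:Z); last first.
  by rewrite big1 // => i _; rewrite big1 // => j _; rewrite E mulr0.
under [RHS]eq_bigr => i _ do under eq_bigr => j _ do rewrite mulPE mulr_sumr.
under [RHS]eq_bigr => i _ do rewrite exchange_big /=.
rewrite exchange_big /= !big_seq; apply: eq_bigr => m /bound[m0 m1].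
rewrite malgU_intmul.
have act1 i j : mono_act m lseries1 i j%:Z
    = ((i == m 0%N) && (j == m 1%N))%:R * lam_part m.
  rewrite /mono_act /mulTL /lseries1 mulrC; case: (leqP (m 0%N) i) => mi.
    by rewrite subr_eq0 -(eqn_add2r (m 0%N)) subnK // add0n.
  by rewrite (ltn_eqF mi) mul0r.
by rewrite pvar_mono; apply/esym; apply: (sum2_pick _ _ _ m0 m1 act1).
Qed.

End LaurentAction.

(** * Expansions of rational functions *)

Section Expansion.

Variables (A : idomainType) (F : fieldType) (f : {rmorphism A -> F}).
Hypothesis f_inj : injective f.
Variables (V : nmodType) (I J : Type).
Local Notation series := (I -> J -> V).
Variables (act : A -> series -> series) (e : series).
Hypothesis actA : forall p q S, act (p * q) S =2 act p (act q S).
Hypothesis eq_act : forall p S T, S =2 T -> act p S =2 act p T.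
Hypothesis act_add : forall p S T,
  act p (fun i j => S i j + T i j) =2 fun i j => act p S i j + act p T i j.
Hypothesis addl_act : forall p q S i j,
  act (p + q) S i j = act p S i j + act q S i j.
Hypothesis act1 : forall S, act 1 S =2 S.
Hypothesis act_inj : forall p q, act p e =2 act q e -> p = q.

(** [expansion] for an abstract module action, with [e] in the place of the series 1. *)
Definition expands (x : F) (S : series) : Prop := exists p q : A,
  [/\ q != 0, x = f p / f q & act q S =2 act p e].

Lemma actC p q S : act p (act q S) =2 act q (act p S).
Proof. by move=> i j; rewrite -!actA mulrC. Qed.

(** Letting [q * q'] act on [S] gives both [p * q'] and [p' * q] acting on [e], and [act_inj]
    compares them. *)
Lemma expands_fun x y S : expands x S -> expands y S -> x = y.
Proof.
move=> [p [q [q0 -> E]]] [p' [q' [q'0 -> E']]].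
suff E'' : p * q' = p' * q.
  by apply/eqP; rewrite eqr_div ?fr_eq0 // -!rmorphM E''.
apply: act_inj => i j.
by rewrite [p * q']mulrC !actA -(eq_act q' E) actC (eq_act q E') actC.
Qed.

Lemma expands_eq x S T : expands x S -> T =2 S -> expands x T.
Proof.
move=> [p [q [q0 xE E]]] TS; exists p, q; split=> // i j.
by rewrite (eq_act q TS).
Qed.

Lemma expands_add x y S T : expands x S -> expands y T ->
  expands (x + y) (fun i j => S i j + T i j).
Proof.
move=> [p [q [q0 -> E]]] [p' [q' [q'0 -> E']]].
exists (p * q' + p' * q), (q * q'); split; first by rewrite mulf_neq0.
  by rewrite addf_div ?fr_eq0 // rmorphD !rmorphM.
move=> i j; rewrite act_add addl_act; congr (_ + _).
  by rewrite [q * q']mulrC [p * q']mulrC !actA (eq_act q' E).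
by rewrite [p' * q]mulrC !actA (eq_act q E').
Qed.

Lemma expands_mul r x S : expands x S -> expands (f r * x) (act r S).
Proof.
move=> [p [q [q0 -> E]]]; exists (r * p), q; split=> //.
  by rewrite rmorphM mulrA.
by move=> i j; rewrite actC (eq_act r E) actA.
Qed.

Lemma expands_of r : expands (f r) (act r e).
Proof.
by exists r, 1; rewrite rmorph1 divr1 oner_neq0; split.
Qed.

Lemma expands_sum (T : eqType) (r : seq T) (x : T -> F) (S : T -> series) :
  (forall k, k \in r -> expands (x k) (S k)) -> (forall i j, act 0 e i j = 0) ->
  expands (\sum_(k <- r) x k) (fun i j => \sum_(k <- r) S k i j).
Proof.
move=> + act0; elim: r => [|k r IH] xS.
  rewrite big_nil -(rmorph0 f).
  by apply: expands_eq (expands_of 0) _ => i j; rewrite big_nil act0.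
have xSk := xS k (mem_head _ _).
have {}IH := IH (fun l lr => xS l (mem_behead (s := k :: r) lr)).
rewrite big_cons; apply: expands_eq (expands_add xSk IH) _ => i j.
by rewrite big_cons.
Qed.

End Expansion.

(* Shifting the index by [k] multiplies the tail sum by [t^a L^-k]; the terms
   which do not come from the tail are those with [0 < r <= k]. *)
Lemma sum_above_rec (Gs : nat -> nat -> lseries) (k a : nat) (S : lseries) :
  (forall m, (k < m)%N -> Gs k m =2 mulTL a (- k%:Z) (Gs k (m - k)%N)) ->
  sum_above k (Gs k) S ->
  mulTL 0 k%:Z S =2
  mulTL a 0 (fun i j => S i j + \sum_(1 <= r < k.+1) Gs k r i j).
Proof.
move=> rec sumS i j; rewrite {1}/mulTL leq0n subn0.
(* [N] is at most [j - k] and [j], the degrees in L at which the two convergences are used. *)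
pose N := (- `|j| - k%:Z)%R.
have [M1 hM1] := sumS i N; have [M2 hM2] := sumS (i - a)%N N.
(* [n] lies past both thresholds and above [k], so that the sum from 1 to [n] can be split after
   [r = k]. *)
pose n := maxn (maxn M1 M2) k.+1.
rewrite -(hM1 (n + k)%N); [|lia|lia].
(* Replacing [m] by [m + k] turns the tail cut at [n + k] into the full sum cut at [n]. *)
have tail : \sum_(k.+1 <= m < n + k) Gs k m i (j - k%:Z) =
    mulTL a 0 (fun i j => \sum_(1 <= r < n) Gs k r i j) i j.
  rewrite -add1n big_addn addnK /mulTL; case: ifP => ai; last first.
    rewrite big_nat big1 // => m hm; rewrite rec; last by lia.
    by rewrite /mulTL ai.
  rewrite !big_nat; apply: eq_bigr => m hm; rewrite rec; last by lia.
  by rewrite /mulTL ai addnK opprK subrK subr0.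
rewrite tail /mulTL; case: ifP => // _; rewrite subr0.
rewrite -(hM2 n); [|lia|lia].
by rewrite (@big_cat_nat _ _ _ k.+1) //= 1?addrC //; lia.
Qed.

(** * Recursions for the rational functions *)

Section Recurrences.

Variables (F : fieldType) (f : {rmorphism lpoly -> F}).
Hypothesis f_inj : injective f.

Lemma mulP_inj p q : mulP p lseries1 =2 mulP q lseries1 -> p = q.
Proof.
move=> E; apply/eqP; rewrite -subr_eq0; apply/eqP/mulP1_eq0 => i j.
apply: (addIr (mulP q lseries1 i j)).
by rewrite add0r -mulPD subrK E.
Qed.

Local Notation expn_of := (expands f mulP lseries1).

Definition expn_fun := expands_fun f_inj mulPA eq_mulP mulP_inj.
Definition expn_eq := @expands_eq _ _ f _ _ _ mulP lseries1 eq_mulP.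
Definition expn_add :=
  @expands_add _ _ f f_inj _ _ _ mulP lseries1 mulPA eq_mulP mulP_add mulPD.
Definition expn_mul := @expands_mul _ _ f _ _ _ mulP lseries1 mulPA eq_mulP.
Definition expn_sum :=
  @expands_sum _ _ f f_inj _ _ _ mulP lseries1 mulPA eq_mulP mulP_add mulPD
    mulP1.
Definition expn_of_poly := @expands_of _ _ f _ _ _ mulP lseries1 mulP1.

Variables (Gs : nat -> nat -> lseries) (G : nat -> nat -> F).
Hypothesis hGs : G_family Gs.
Hypothesis hG : forall k m, (0 < k)%N -> (0 < m)%N -> expn_of (G k m) (Gs k m).

Lemma G11_rec : f (pvar 1 ^+ 2) * G 1 1 = f ((pvar 1 - 1) ^+ 2).
Proof.
have [_ h11 _ _ _] := hGs.
have E := expn_mul (pvar 1 ^+ 2) (hG (isT : 0 < 1)%N (isT : 0 < 1)%N).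
apply: (expn_fun E).
apply: expn_eq (expn_of_poly _) _ => i j.
etransitivity; first exact: (mulP_LX 2).
etransitivity; first exact: (eq_mulTL 0 2 h11).
etransitivity; first exact: mulTL_comp.
by rewrite /mulTL subn0 subr0.
Qed.

Lemma Gsym_rec k m : (0 < k)%N -> (0 < m)%N -> G k m = G m k.
Proof.
have [_ _ hsym _ _] := hGs => k0 m0.
apply: expn_fun (hG k0 m0) _; apply: expn_eq (hG m0 k0) _; exact: hsym.
Qed.

Lemma Glt_rec k m : (0 < k)%N -> (k < m)%N ->
  f (pvar 1 ^+ k) * G k m = f (pvar 0 ^+ (k * (k - 1))) * G k (m - k)%N.
Proof.
have [_ _ _ hlt _] := hGs => k0 km.
have m0 : (0 < m)%N by lia.
have mk0 : (0 < m - k)%N by lia.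
apply: (expn_fun (expn_mul (pvar 1 ^+ k) (hG k0 m0))).
apply: expn_eq (expn_mul (pvar 0 ^+ (k * (k - 1))) (hG k0 mk0)) _ => i j.
etransitivity; first exact: mulP_LX.
etransitivity; first exact: (eq_mulTL 0 k (hlt k m k0 km)).
etransitivity; first exact: mulTL_comp.
by rewrite subrr; apply/esym/mulP_tX.
Qed.

(** The tail sum is eliminated among series: multiplying [sum_above_rec] by [pvar k - 1] turns each
    [S] back into [Gs k k], which leaves only entries of the family. *)
Lemma Gdiag_rec k : (0 < k)%N ->
  f (pvar 1 ^+ k) * G k k = f (pvar 0 ^+ (k * (k - 1))) *
    (G k k + f (pvar k - 1) * \sum_(1 <= r < k.+1) G k r).
Proof.
have [_ _ _ hlt hdiag] := hGs => k0.
have [S [_ sumS] GS] := hdiag k k0.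
have rec := sum_above_rec (fun m => hlt k m k0) sumS.
apply: (expn_fun (expn_mul (pvar 1 ^+ k) (hG k0 k0))).
set T := fun i j => \sum_(1 <= r < k.+1) Gs k r i j.
have eT : expn_of (\sum_(1 <= r < k.+1) G k r) T.
  apply: expn_sum => [r|]; last exact: mulP0.
  by rewrite mem_index_iota => /andP[r0 _]; apply: hG.
have E := expn_add (hG k0 k0) (expn_mul (pvar k - 1) eT).
apply: expn_eq (expn_mul (pvar 0 ^+ (k * (k - 1))) E) _ => i j.
etransitivity; first exact: (eq_mulP _ GS).
etransitivity; first exact: mulPC.
etransitivity; first exact: (eq_mulP _ (mulP_LX k S)).
etransitivity; first exact: (eq_mulP _ rec).
etransitivity; first by apply: eq_mulP => {}i {}j; apply/esym/mulP_tX.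
etransitivity; first exact: mulPC.
apply: eq_mulP => {}i {}j; etransitivity; first exact: mulP_add.
by rewrite GS.
Qed.

End Recurrences.

(** * Partial derivatives of polynomials *)

(** For additive [D] both sides are biadditive, so products of single summands suffice. *)
Lemma leibniz_sum (R : comNzRingType) (D : R -> R) (I J : Type)
    (r : seq I) (s : seq J) (a : I -> R) (b : J -> R) :
  {morph D : x y / x + y} -> D 0 = 0 ->
  (forall i j, D (a i * b j) = D (a i) * b j + a i * D (b j)) ->
  D ((\sum_(i <- r) a i) * \sum_(j <- s) b j) =
  D (\sum_(i <- r) a i) * \sum_(j <- s) b j
  + (\sum_(i <- r) a i) * D (\sum_(j <- s) b j).
Proof.
move=> DD D0 Dab; have Dsum := big_morph D DD D0.
rewrite mulr_suml !Dsum !mulr_suml -big_split /=; apply: eq_bigr => i _.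
rewrite !mulr_sumr Dsum -big_split /=; apply: eq_bigr => j _; exact: Dab.
Qed.

Section PartialDerivative.

Variable i : nat.
Implicit Types (p q : lpoly) (m : {cmonom nat}).

Lemma pderivEw (d : {fset {cmonom nat}}) p : (msupp p `<=` d)%fset ->
  pderiv i p = \sum_(m <- d) << p@_m *+ m i *g divcm m (ucm i) >>.
Proof.
move=> le; rewrite /pderiv (big_fset_incl _ le) // => m _ /mcoeff_outdom ->.
by rewrite mul0rn monalgU0.
Qed.

Lemma pderivU (c : int) m :
  pderiv i (<< c *g m >> : lpoly) = << c *+ m i *g divcm m (ucm i) >>.
Proof. by rewrite (pderivEw msuppU_le) big_seq_fset1 mcoeffUU. Qed.

Lemma pderiv0 : pderiv i 0 = 0.
Proof. by rewrite /pderiv msupp0 big_seq_fset0. Qed.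

Lemma pderivD : {morph pderiv i : p q / p + q}.
Proof.
move=> p q; rewrite (pderivEw (msuppD_le p q)).
rewrite (pderivEw (fsubsetUl (msupp p) (msupp q))).
rewrite (pderivEw (fsubsetUr (msupp p) (msupp q))) -big_split /=.
by apply: eq_bigr => m _; rewrite mcoeffD mulrnDl monalgUD.
Qed.

Lemma malgUM (c c' : int) (m m' : {cmonom nat}) :
  << c *g m >> * << c' *g m' >> = << c * c' *g (m * m')%M >> :> {malg int[_]}.
Proof. by rewrite malgM_def fgmulUU. Qed.

Lemma divcm_ucm_mul m m' : (0 < m i)%N ->
  (divcm m (ucm i) * m')%M = divcm (m * m')%M (ucm i).
Proof.
move=> mi; apply/eqP/cmP => j; rewrite cmM !divcmE cmM ucmE.
by case: eqP => [<-|_]; lia.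
Qed.

Lemma pderivUMl (c c' : int) m m' :
  pderiv i (<< c *g m >> : lpoly) * << c' *g m' >> =
  << (c * c') *+ m i *g divcm (m * m')%M (ucm i) >>.
Proof.
rewrite pderivU; etransitivity; first exact: malgUM.
(* For [m i = 0] both coefficients vanish, while the truncated quotients [divcm] need not agree. *)
case: (posnP (m i)) => [->|mi].
  have z : c *+ 0 * c' = 0 by rewrite mulr0n mul0r.
  etransitivity; first exact: congr1 z.
  by etransitivity; [|apply/esym]; exact: monalgU0.
exact: congr2 (divcm_ucm_mul _ mi) (mulrnAl _ _ _).
Qed.

Lemma pderivUM (c c' : int) m m' :
  pderiv i ((<< c *g m >> : lpoly) * (<< c' *g m' >> : lpoly)) =
  pderiv i (<< c *g m >> : lpoly) * << c' *g m' >>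
  + << c *g m >> * pderiv i (<< c' *g m' >> : lpoly).
Proof.
etransitivity; first exact: (congr1 (pderiv i) (malgUM _ _ _ _)).
etransitivity; first exact: pderivU.
have E : (c * c') *+ (m * m')%M i = (c * c') *+ m i + (c * c') *+ m' i.
  by rewrite cmM mulrnDr.
etransitivity; first exact: congr1 E.
etransitivity; first exact: monalgUD.
apply: congr2; first exact/esym/pderivUMl.
etransitivity; last exact: mulrC.
apply: esym; etransitivity; first exact: pderivUMl.
by rewrite mulrC mulmC.
Qed.

Lemma pderivM p q : pderiv i (p * q) = pderiv i p * q + p * pderiv i q.
Proof.
have := @leibniz_sum lpoly (pderiv i) _ _ (msupp p) (msupp q)
  (fun m => << p@_m *g m >>) (fun m => << q@_m *g m >>) pderivD pderiv0
  (fun m m' => pderivUM p@_m q@_m' m m').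
by rewrite -!monalgE.
Qed.

Lemma pderiv_pvar j : pderiv i (pvar j) = (i == j)%:R.
Proof.
rewrite pderivU ucmE eq_sym; case: eqP => [->|_]; last by rewrite monalgU0.
rewrite (_ : divcm _ _ = mone) //; apply/eqP/cmP => k.
by rewrite divcmE subnn cm1.
Qed.

End PartialDerivative.

(** * The derivatives of H *)

Section Main.

Variables (A : idomainType) (F : fieldType) (f : {rmorphism A -> F}).
Hypothesis f_inj : injective f.
Hypothesis f_surj : forall x, exists p q, q != 0 /\ x = f p / f q.
Variables (X : nat -> A) (subst : (nat -> A) -> {rmorphism A -> A}).
Hypothesis substX : forall s i, subst s (X i) = s i.
Variable D : nat -> A -> A.
Hypothesis DD : forall i, {morph D i : p q / p + q}.
Hypothesis DM : forall i p q, D i (p * q) = D i p * q + p * D i q.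
Hypothesis DX : forall i j, D i (X j) = (i == j)%:R.
Variables (d : nat -> F -> F) (fs : (nat -> A) -> F -> F).
Hypothesis dE : forall i p q, q != 0 -> d i (f p / f q) = quot_rule f (D i) p q.
Hypothesis fsE : forall s x y, place f (subst s) x y -> fs s x = y.

Variable G : nat -> nat -> F.
Hypothesis G11 : f (X 1 ^+ 2) * G 1 1 = f ((X 1 - 1) ^+ 2).
Hypothesis Gsym : forall k m, (0 < k)%N -> (0 < m)%N -> G k m = G m k.
Hypothesis Glt : forall k m, (0 < k)%N -> (k < m)%N ->
  f (X 1 ^+ k) * G k m = f (X 0 ^+ (k * (k - 1))) * G k (m - k)%N.
Hypothesis Gdiag : forall k, (0 < k)%N ->
  f (X 1 ^+ k) * G k k = f (X 0 ^+ (k * (k - 1))) *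
    (G k k + f (X k - 1) * \sum_(1 <= r < k.+1) G k r).

Let lam i := f (X i).
Let L := f (X 1).

(** Elements of [F] coming from [A] are told apart by specializing the variables; each nonvanishing
    fact proved this way picks suitable values 0 and 1. *)
Let neq_subst (s : nat -> A) p q : subst s p != subst s q -> f p != f q.
Proof. by apply: contraNneq => /f_inj ->. Qed.

Let L_neq0 : L != 0.
Proof.
rewrite -(rmorph0 f); apply: (@neq_subst (fun=> 1)).
by rewrite substX rmorph0 oner_neq0.
Qed.

Let L_ord k : (0 < k)%N -> L ^+ k != 1.
Proof.
move=> k0; rewrite -rmorphXn -(rmorph1 f); apply: (@neq_subst (fun=> 0)).
by rewrite rmorphXn rmorph1 substX expr0n gtn_eqF //= eq_sym oner_neq0.
Qed.

Let lam_neq1 k : (1 < k)%N -> lam k - 1 != 0.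
Proof.
move=> _; rewrite subr_eq0 -(rmorph1 f); apply: (@neq_subst (fun=> 0)).
by rewrite substX rmorph1 eq_sym oner_neq0.
Qed.

Let lam_neqL k : (1 < k)%N -> L ^+ k - lam k != 0.
Proof.
move=> k1; rewrite subr_eq0 -rmorphXn.
apply: (@neq_subst (fun i => (i == 1%N)%:R)).
by rewrite rmorphXn !substX eqxx expr1n gtn_eqF // oner_neq0.
Qed.

Let lam_neqLV k : (1 < k)%N -> 1 - lam k * L ^- k != 0.
Proof. exact: (lam_neqLV (X := X) L_neq0 lam_neqL). Qed.

(** The substitutions of [at_t1], [all_lam_to_L] and [adams], spelled alike so that [Hc], [Hg] and
    [Hp] become convertible to [Hcoef], [Hgen] and [Hpow]. *)
Let s1 i := if i == 0%N then 1 else X i.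
Let sL i := if i == 0%N then X 0 else X 1.
Let sA al i :=
  if i == 0%N then X 0 else if i == 1%N then X 1 ^+ al else X (i * al)%N.

Definition Hc k m := fs s1 (G k m) / fs sL (fs s1 (G k m)).

Let HcE k m : (0 < k)%N -> (0 < m)%N -> Hc k m = hval L lam (gcdn k m).
Proof.
move=> k0 m0; rewrite /Hc.
have -> : fs s1 (G k m) = Gval f X k m.
  apply: fsE; apply: place_t1_G => //.
  - by rewrite substX.
  - by case=> // i _; rewrite substX.
rewrite (fsE (y := (L - 1) ^+ 2 * L ^- (k + m))); first exact: Gval_ratio.
by apply: place_L_G => //; case=> // i _; rewrite substX.
Qed.

Let fs_adams a n : (0 < a)%N -> fs (sA a) (hval L lam n) = hadams lam a n.
Proof.
move=> a0; apply: fsE; apply: place_adams_hval => //; first by rewrite substX.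
by move=> [|[|i]] // _; rewrite substX.
Qed.

Let d_der i : is_derivation (d i).
Proof.
split; first exact: (quot_ruleD f_inj (DD i) (DM i) (dE i) f_surj).
exact: (quot_ruleM f_inj (DM i) (dE i) f_surj).
Qed.

Let d_lam i j : (0 < j)%N -> d i (lam j) = (i == j)%:R.
Proof.
move=> _; rewrite /lam (quot_rule_of (DM i) (dE i)) DX.
by case: eqP => _; rewrite ?rmorph1 ?rmorph0.
Qed.

Definition Hg u v : F := if (0 < u)%N && (0 < v)%N then Hc u v else 0.

Definition Hp al u v : F :=
  if [&& (0 < u)%N, (0 < v)%N, (al %| u)%N & (al %| v)%N]
  then fs (sA al) (Hc (u %/ al) (v %/ al)) else 0.

Let HpE al u v : (0 < al)%N -> (0 < u)%N -> (0 < v)%N ->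
  Hp al u v =
  if (al %| gcdn u v)%N then hadams lam al (gcdn u v %/ al) else 0.
Proof.
move=> al0 u0 v0; rewrite /Hp u0 v0 dvdn_gcd /=.
case: ifP => // /andP[/dvdnP[u' uE] /dvdnP[v' vE]]; subst u v.
rewrite !mulnK // -muln_gcdl mulnK // HcE ?fs_adams //.
  by move: u0; rewrite muln_gt0 => /andP[].
by move: v0; rewrite muln_gt0 => /andP[].
Qed.

(** For positive [u] and [v] everything depends on [gcdn u v] only, and [al] divides it iff it
    divides both. The two parts are then [dl_hval] and [iter_dl_chain] at this gcd. *)
Lemma main_rule :
  (forall al : nat, (2 <= al)%N -> forall u v : nat,
     d al (Hg u v) =
       (1 - L ^- al) / ((lam al - 1) * (1 - lam al * L ^- al))
       * Hc al al * Hp al u v)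
  /\
  (forall (n : nat) (al ks : nat -> nat),
     (0 < n)%N -> (2 <= al 1)%N ->
     (forall j : nat, (1 <= j < n)%N -> (al j < al j.+1)%N) ->
     (forall j : nat, (1 <= j <= n)%N -> (0 < ks j)%N) ->
     ((forall j : nat, (1 <= j < n)%N -> (al j %| al j.+1)%N) ->
      forall u v : nat,
        foldr (fun j => iter (ks j) (d (al j))) (Hg u v) (iota 1 n) =
          (\prod_(1 <= j < n.+1)
             ((1 - L ^- al j) * ((ks j)`!%:R * L ^- (al j * (ks j - 1)))
              / ((lam (al j) - 1) * (1 - lam (al j) * L ^- al j) ^+ ks j)))
          * Hc (al 1%N) (al 1%N)
          * (\prod_(2 <= j < n.+1)
               fs (sA (al j.-1)) (Hc (al j %/ al j.-1) (al j %/ al j.-1)))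
          * Hp (al n) u v)
     /\
     ((exists2 j : nat, (1 <= j < n)%N & ~~ (al j %| al j.+1)%N) ->
      forall u v : nat,
        foldr (fun j => iter (ks j) (d (al j))) (Hg u v) (iota 1 n) = 0)).
Proof.
have Hcc a : (0 < a)%N -> Hc a a = hval L lam a.
  by move=> a0; rewrite HcE // gcdnn.
have foldr0 al ks s : foldr (fun j => iter (ks j) (d (al j))) 0 s = 0.
  by elim: s => //= j s ->; rewrite iter_der0.
split=> [al al2 u v|n al ks n0 al2 mono ksp].
  have al0 : (0 < al)%N by lia.
  rewrite /Hg; case: (boolP ((0 < u)%N && (0 < v)%N)) => [/andP[u0 v0]|nuv].
    rewrite HcE // (dl_hval d_der d_lam) ?gcdn_gt0 ?u0 // Hcc // HpE //.
    rewrite /hfactor (factS 0) fact0 subnn muln0 expr0 invr1 !mulr1 expr1.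
    by case: ifP; rewrite ?mulr0.
  rewrite der0 // /Hp.
  case: ifP => [/and4P[u0 v0 _ _]|_]; last by rewrite mulr0.
  by case/negP: nuv; rewrite u0.
(* [iter_dl_chain] counts the links between consecutive indices, one fewer than the variables. *)
case: n n0 mono ksp => // n _ mono ksp.
have al_gt1 j : (1 <= j <= n.+1)%N -> (1 < al j)%N.
  elim: j => [|[|j] IH] // hj; apply: ltn_trans (IH _) (mono _ _); lia.
have mono1 j : (1 <= j < 1 + n)%N -> (al j < al j.+1)%N.
  by rewrite add1n; apply: mono.
have ksp1 j : (1 <= j <= 1 + n)%N -> (0 < ks j)%N by rewrite add1n; apply: ksp.
have chain u v (u0 : (0 < u)%N) (v0 : (0 < v)%N) :=
  iter_dl_chain d_der d_lam L_neq0 lam_neq1 lam_neqLV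
    (al := al) (ks := ks) (N := gcdn u v) (i := 1) (n := n).
split=> [dv u v|[j jn ndv] u v]; rewrite /Hg; last first.
  case: ifP => [/andP[u0 v0]|_]; last exact: foldr0.
  rewrite HcE // chain // ?gcdn_gt0 ?u0 //.
  case: ifP => // /andP[/allP dv _]; case/negP: ndv; apply: dv.
  by rewrite mem_iota add1n.
case: (boolP ((0 < u)%N && (0 < v)%N)) => [/andP[u0 v0]|nuv]; last first.
  (* If [u] or [v] is 0, both sides vanish by the conventions in [Hg] and [Hp]. *)
  rewrite foldr0 /Hp; case: ifP => [/and4P[u0 v0 _ _]|_]; last by rewrite mulr0.
  by case/negP: nuv; rewrite u0.
rewrite HcE // chain // ?gcdn_gt0 ?u0 // add1n.
have -> : all (fun j => al j %| al j.+1)%N (iota 1 n).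
  by apply/allP => j; rewrite mem_iota add1n; apply: dv.
rewrite andTb HpE //; last by have := al_gt1 n.+1; lia.
case: ifP => _; last by rewrite mulr0.
rewrite Hcc; last by lia.
congr (_ * _ * _ * _); rewrite !big_nat; apply: eq_bigr => j hj.
have a1 : (1 < al j.-1)%N by apply: al_gt1; lia.
have a2 : (al j.-1 < al j)%N by rewrite -{2}[j]prednK ?mono //; lia.
by rewrite Hcc ?fs_adams // ?divn_gt0; lia.
Qed.

End Main.

(** * Specialization to the fraction field of [lpoly] *)

HB.instance Definition _ :=
  GRing.RMorphism.copy frac_of (@FracField.tofrac lpoly).

Lemma tofrac_inj (R : idomainType) : injective (@FracField.tofrac R).
Proof. by move=> p q /eqP; rewrite tofrac_eq => /eqP. Qed.

Lemma tofrac_repr (R : idomainType) (x : {fraction R}) :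
  x = FracField.tofrac \n_(repr x) / FracField.tofrac \d_(repr x).
Proof.
apply: (canRL (mulfK _)); first by rewrite tofrac_eq0 denom_ratioP.
rewrite -{1}[x]reprK; case: (repr x) => -[n d] /= d0.
unlock FracField.tofrac; rewrite -[LHS]FracField.pi_mul.
apply/eqmodP => /=; rewrite FracField.equivfE /FracField.mulf /=.
by rewrite !numden_Ratio ?mulf_neq0 ?oner_eq0 //=; rewrite !mulr1 mulrC.
Qed.

Lemma tofrac_quot_rule (R : idomainType) (D : R -> R) (p q : R) :
  (forall p q, D (p * q) = D p * q + p * D q) -> q != 0 ->
  let x := FracField.tofrac p / FracField.tofrac q in
  quot_rule (@FracField.tofrac R) D \n_(repr x) \d_(repr x) =
  quot_rule (@FracField.tofrac R) D p q.
Proof.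
move=> DM q0 x; apply: (quot_rule_eq (@tofrac_inj R) DM _ q0).
  exact: denom_ratioP.
by rewrite -tofrac_repr.
Qed.

Lemma tofrac_surj (R : idomainType) (x : {fraction R}) :
  exists p q : R, q != 0 /\ x = FracField.tofrac p / FracField.tofrac q.
Proof.
exists \n_(repr x), \d_(repr x); split; first exact: denom_ratioP.
exact: tofrac_repr.
Qed.

Lemma frac_of_inj : injective frac_of.
Proof. exact: (@tofrac_inj lpoly). Qed.

Lemma frac_of_surj (x : ratfun) :
  exists p q : lpoly, q != 0 /\ x = frac_of p / frac_of q.
Proof. exact: (@tofrac_surj lpoly). Qed.

Lemma dlam_frac i (p q : lpoly) : q != 0 ->
  dlam i (frac_of p / frac_of q) = quot_rule frac_of (pderiv i) p q.
Proof. by move=> q0; exact: (@tofrac_quot_rule lpoly _ p q (pderivM i) q0). Qed.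

(** By [place_fun] at most one value is possible, so [epsilon] returns it. *)
Lemma fsubst_place (s : nat -> lpoly) (x y : ratfun) :
  place frac_of (psubst s) x y -> fsubst s x = y.
Proof.
move=> xy; apply: (place_fun frac_of_inj _ xy).
exact: (epsilon_spec (inhabits (0 : ratfun)) (place frac_of (psubst s) x)
  (ex_intro _ y xy)).
Qed.

(* In the second part the printed factor L^(al_j (k_j - 1)) is false as soon as
   some k_j >= 2; the factor obtained by differentiating the first part is
   k_j! L^(- al_j (k_j - 1)), which is the one used here. They agree if all
   k_j = 1. *)
Theorem theorem4 (Gs : nat -> nat -> lseries) (G : nat -> nat -> ratfun)
    (hGs : G_family Gs)
    (hG : forall k m : nat, (0 < k)%N -> (0 < m)%N -> expansion (G k m) (Gs k m)) :
  (forall al : nat, (2 <= al)%N -> forall u v : nat,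
     dlam al (Hgen G u v) =
       (1 - Lvar ^- al) / ((lam al - 1) * (1 - lam al * Lvar ^- al))
       * Hcoef G al al * Hpow G al u v)
  /\
  (forall (n : nat) (al ks : nat -> nat),
     (0 < n)%N -> (2 <= al 1)%N ->
     (forall j : nat, (1 <= j < n)%N -> (al j < al j.+1)%N) ->
     (forall j : nat, (1 <= j <= n)%N -> (0 < ks j)%N) ->
     ((forall j : nat, (1 <= j < n)%N -> (al j %| al j.+1)%N) ->
      forall u v : nat,
        iter_dlam n al ks (Hgen G u v) =
          (\prod_(1 <= j < n.+1)
             ((1 - Lvar ^- al j) * ((ks j)`!%:R * Lvar ^- (al j * (ks j - 1)))
              / ((lam (al j) - 1) * (1 - lam (al j) * Lvar ^- al j) ^+ ks j)))
          * Hcoef G (al 1%N) (al 1%N)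
          * (\prod_(2 <= j < n.+1)
               adams (al j.-1) (Hcoef G (al j %/ al j.-1) (al j %/ al j.-1)))
          * Hpow G (al n) u v)
     /\
     ((exists2 j : nat, (1 <= j < n)%N & ~~ (al j %| al j.+1)%N) ->
      forall u v : nat, iter_dlam n al ks (Hgen G u v) = 0)).
Proof.
(* [expansion] is convertible to [expands] for the action [mulP] and the series [lseries1]. *)
have hG' k m : (0 < k)%N -> (0 < m)%N ->
  expands frac_of mulP lseries1 (G k m) (Gs k m) := hG k m.
have E11 := G11_rec frac_of_inj hGs hG'.
have Esym := Gsym_rec frac_of_inj hGs hG'.
have Elt := Glt_rec frac_of_inj hGs hG'.
have Ediag := Gdiag_rec frac_of_inj hGs hG'.
exact: (@main_rule lpoly ratfun frac_of frac_of_inj frac_of_surj pvar psubst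
  psubst_pvar pderiv pderivD pderivM pderiv_pvar dlam fsubst dlam_frac
  fsubst_place G E11 Esym Elt Ediag).
Qed.
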